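(* Let $V$ be a vertex operator algebra over $\mathbb{R}$ satisfying the standing assumptions described in the context, with Griess algebra $B=V_2$, and let $B_{e,f}$ denote the subalgebra of $B$ generated by two Ising vectors $e$ and $f$. Then $\dim B_{e,f}\leq 8$, and the structure of $B_{e,f}$ is uniquely determined by $(e|f)$ and $(e|e^{\tau_f})$, in the following sense: if $V'$ is another vertex operator algebra satisfying the same standing assumptions, with Ising vectors $e',f'$ such that $(e'|f')=(e|f)$ and $(e'|e'^{\tau_{f'}})=(e|e^{\tau_f})$, then there is an isomorphism of algebras $B_{e,f}\to B_{e',f'}$ that preserves the bilinear forms and maps $e\mapsto e'$, $f\mapsto f'$.
   Context: Standing assumptions: $V=(V,Y,\mathbf{1},\omega)$ is a vertex operator algebra over $\mathbb{R}$, with $Y(v,z)=\sum_{n\in\mathbb{Z}}v_{(n)}z^{-n-1}$, graded as $V=\bigoplus_{n=0}^\infty V_n$ with $V_0=\mathbb{R}\mathbf{1}$ and $V_1=0$. Such a $V$ has a unique invariant bilinear form $\langle\cdot,\cdot\rangle$ with $\langle\mathbf{1},\mathbf{1}\rangle=1$, and it is assumed to be positive-definite. Griess algebra: $B=V_2$ with product $x\cdot y=x_{(1)}y$ and bilinear form given by $\langle x,y\rangle\mathbf{1}=x_{(3)}y$. It is a commutative non-associative algebra with symmetric form satisfying $\langle x\cdot y,z\rangle=\langle x,y\cdot z\rangle$. Ising vectors: a vector $a\in V_2$ is a conformal vector with central charge $c$ if $a_{(1)}a=2a$ and $a_{(3)}a=\frac{c}{2}\mathbf{1}$. It is an Ising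 vector if $c=1/2$ and $a$ generates the simple Virasoro vertex operator algebra $L(1/2,0)$, which is rational with irreducible modules $L(1/2,0)$, $L(1/2,1/2)$, $L(1/2,1/16)$. For an Ising vector $a$ and $h\in\{0,1/2,1/16\}$, $V_a(h)$ is the sum of all submodules of $V$ isomorphic to $L(1/2,h)$ as modules over the Virasoro vertex operator algebra generated by $a$; one has $V=V_a(0)\oplus V_a(1/2)\oplus V_a(1/16)$. The $\tau$-involution $\tau_a$ is the automorphism of $V$ equal to $1$ on $V_a(0)\oplus V_a(1/2)$ and $-1$ on $V_a(1/16)$. Automorphisms act on the right: $x^\sigma$ is the image of $x$ under $\sigma$, and $x^{\sigma\sigma'}=(x^\sigma)^{\sigma'}$. For an Ising vector $a$ and $x\in B$, $(a|x)=\langle a,x\rangle/\langle a,a\rangle=4\langle a,x\rangle$. *)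

(* Defs.v *)
From HB Require Import structures.
From mathcomp Require Import all_boot all_order all_algebra.
From mathcomp Require Import all_classical all_reals.

Set Implicit Arguments.
Unset Strict Implicit.
Unset Printing Implicit Defensive.

Import Order.TTheory GRing.Theory Num.Theory.
Local Open Scope classical_set_scope.
Local Open Scope ring_scope.

Section LinearAlgebra.
Variables (R : realType) (V : lmodType R).

Definition subspace (W : set V) : Prop :=
  W 0 /\ forall (c : R) (u v : V), W u -> W v -> W (c *: u + v).

(* For a subspace W: dim W <= n. *)
Definition dim_le (W : set V) (n : nat) : Prop :=
  exists b : 'I_n -> V,
    (forall i, W (b i)) /\
    (forall x, W x -> exists c : 'I_n -> R, x = \sum_(i < n) c i *: b i).

End LinearAlgebra.

(* The binomial coefficient p (p - 1) ... (p - i + 1) / i! for p in Z. *)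
Definition binz (R : realType) (p : int) (i : nat) : R :=
  (\prod_(j < i) (p - (j : nat)%:Z)%:~R) / (i`!)%:R.

(* Vertex operator algebras over R graded by the natural numbers.
   nprod n u v is u_(n) v, where Y(u, z) = \sum_n u_(n) z^(- n - 1).
   The sums over [set: nat] have finite support, by truncation. *)
Record voa (R : realType) := Voa {
  carrier :> lmodType R;
  nprod : int -> carrier -> carrier -> carrier;
  vac : carrier;
  conf : carrier;
  grade : nat -> set carrier;
  central_charge : R;

  nprod_linearr : forall n u, linear (nprod n u);
  nprod_linearl : forall n v, linear (nprod n ^~ v);
  nprod_trunc : forall u v, exists N : int,
    forall n : int, N <= n -> nprod n u v = 0;

  vac_nprod : forall n v, nprod n vac v = if n == -1 then v else 0;
  nprod_vacN1 : forall u, nprod (-1) u vac = u;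
  nprod_vac_ge0 : forall (n : int) u, 0 <= n -> nprod n u vac = 0;

  borcherds : forall (p q r : int) (u v w : carrier),
    \sum_(i \in [set: nat])
       binz R p i *: nprod (p + q - i%:Z) (nprod (r + i%:Z) u v) w
    = \sum_(i \in [set: nat])
       ((-1) ^+ i * binz R r i) *:
         (nprod (p + r - i%:Z) u (nprod (q + i%:Z) v w)
          - (-1) ^ r *: nprod (q + r - i%:Z) v (nprod (p + i%:Z) u w));

  (* L(n) = conf_(n + 1) *)
  virasoro : forall (m n : int) v,
    nprod (m + 1) conf (nprod (n + 1) conf v)
    - nprod (n + 1) conf (nprod (m + 1) conf v)
    = (m - n)%:~R *: nprod (m + n + 1) conf v
      + (if m + n == 0
         then ((m ^+ 3 - m)%:~R / 12%:R * central_charge) *: v else 0);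
  LN1_deriv : forall (n : int) u v,
    nprod n (nprod 0 conf u) v = - n%:~R *: nprod (n - 1) u v;

  grade_subspace : forall n, subspace (grade n);
  grade_findim : forall n, exists d, dim_le (grade n) d;
  grade_sum : forall v, exists (N : nat) (s : nat -> carrier),
    (forall i, grade i (s i)) /\ v = \sum_(i < N) s i;
  grade_direct : forall (N : nat) (s : nat -> carrier),
    (forall i, grade i (s i)) -> \sum_(i < N) s i = 0 ->
    forall i, (i < N)%N -> s i = 0;
  grade_L0 : forall n v, grade n v -> nprod 1 conf v = n%:R *: v;
  grade_vac : grade 0 vac;
  grade_conf : grade 2 conf
}.

Arguments vac {R} _.
Arguments conf {R} _.
Arguments grade {R} _ _.

(* Coefficientwise form of
   <Y(a, z) u, v> = <u, Y(e^(z L(1)) (- z^(-2))^L(0) a, z^(-1)) v>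
   for a of weight k; L(1)^i a = 0 for i > k since it has weight k - i. *)
Definition invariant_form (R : realType) (V : voa R) (b : V -> V -> R) : Prop :=
  [/\ forall u, scalar (b u),
      forall v, scalar (b ^~ v) &
      forall (k : nat) (n : int) (a u v : V), grade V k a ->
        b (nprod n a u) v =
        (-1) ^+ k * \sum_(i < k.+1) (i`!)%:R^-1 *
          b u (nprod (2 * k%:Z - n - (i : nat)%:Z - 2)
                 (iter i (nprod 2 (conf V)) a) v)].

Definition standing (R : realType) (V : voa R) : Prop :=
  [/\ grade V 0 = [set x | exists r : R, x = r *: vac V],
      grade V 1 = [set 0] &
      exists b : V -> V -> R,
        [/\ invariant_form b, b (vac V) (vac V) = 1 &
            forall v : V, v != 0 -> 0 < b v v]].

Section Griess.
Variables (R : realType) (V : voa R).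
Implicit Types a e f x y : V.

Definition griess_mul x y : V := nprod 1 x y.

(* The scalar <x, y> with x_(3) y = <x, y> 1. *)
Definition griess_form x y : R :=
  xget 0 [set r : R | nprod 3 x y = r *: vac V].

(* (a|x) *)
Definition norm_form a x : R := griess_form a x / griess_form a a.

Definition griess_subalgebra (W : set V) : Prop :=
  [/\ subspace W, W `<=` grade V 2 &
      forall x y, W x -> W y -> W (griess_mul x y)].

Definition griess_gen e f : set V := smallest griess_subalgebra [set e; f].

Definition conformal_vector (c : R) a : Prop :=
  [/\ grade V 2 a, nprod 1 a a = 2%:R *: a &
      nprod 3 a a = (c / 2%:R) *: vac V].

Definition vertex_subalgebra (W : set V) : Prop :=
  [/\ subspace W, W (vac V) &
      forall (n : int) x y, W x -> W y -> W (nprod n x y)].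

Definition vir a : set V := smallest vertex_subalgebra [set a].

Definition vir_submodule a (W : set V) : Prop :=
  subspace W /\
  forall (n : int) x y, vir a x -> W y -> W (nprod n x y).

Definition vir_irreducible a (W : set V) : Prop :=
  [/\ vir_submodule a W, W != [set 0] &
      forall W' : set V, vir_submodule a W' -> W' `<=` W ->
        W' = [set 0] \/ W' = W].

(* For a conformal vector a of central charge c, put L^a(n) = a_(n + 1).
   L(c, h) is the irreducible module with a highest weight vector of weight h,
   for the Virasoro algebra with central charge c; hence W is a copy of L(c, h)
   iff the following holds.  The central charge is fixed by a. *)
Definition is_L a (h : R) (W : set V) : Prop :=
  vir_irreducible a W /\
  exists v : V, [/\ W v, v != 0, nprod 1 a v = h *: v &
    forall n : int, 0 < n -> nprod (n + 1) a v = 0].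

Definition ising a : Prop :=
  conformal_vector (1 / 2%:R) a /\ is_L a 0 (vir a).

(* V_a(h), the sum of all submodules isomorphic to L(1/2, h). *)
Definition isotypic a (h : R) : set V :=
  smallest (@subspace R V) (\bigcup_(W in [set W | is_L a h W]) W).

Definition automorphism (t : V -> V) : Prop :=
  [/\ linear t, bijective t,
      forall (n : int) x y, t (nprod n x y) = nprod n (t x) (t y),
      t (vac V) = vac V & t (conf V) = conf V].

Definition is_tau a (t : V -> V) : Prop :=
  [/\ automorphism t,
      forall x, isotypic a 0 x -> t x = x,
      forall x, isotypic a (1 / 2%:R) x -> t x = x &
      forall x, isotypic a (1 / 16%:R) x -> t x = - x].

(* The tau-involution; the default value idfun is never used when a is an Ising
   vector in an algebra satisfying [standing]. *)
Definition tau a : V -> V := xget (idfun : V -> V) [set t | is_tau a t].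

End Griess.

(* phi restricts to an isomorphism from the Griess subalgebra W onto W'
   preserving the forms; its values outside W are irrelevant. *)
Definition griess_isometry (R : realType) (V V' : voa R)
    (W : set V) (W' : set V') (phi : V -> V') : Prop :=
  [/\ set_bij W W' phi,
      forall (c : R) (x y : V), W x -> W y ->
        phi (c *: x + y) = c *: phi x + phi y,
      forall x y : V, W x -> W y ->
        phi (griess_mul x y) = griess_mul (phi x) (phi y) &
      forall x y : V, W x -> W y ->
        griess_form (phi x) (phi y) = griess_form x y].

(* Main.v *)
(* For an Ising vector a, positivity of the form makes V a unitary module of the
   Virasoro algebra L^a(n) = a_(n+1) with c = 1/2.  The singular vector of weight 6
   has norm 0, so it vanishes, and its zero mode gives h (2 h - 1) (16 h - 1) = 0 for
   highest weight vectors.  The null vectors of weights h + 1 and h + 2 then give the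
   Ising fusion rules for three-point functions of highest weight vectors, first
   for B = V_2 and, by descending to all of V, the Z/2-grading behind tau_a.

   On B, rescaled so that e and f are idempotents a_0 and a_1, write
   s(x, y) = x y - (x + y) / 32, and let a_-1, a_2, a_-2 be the images of a_1 and a_0
   under the two involutions.  With S = s(a_0, a_1) and Y = s(a_1, a_-1), the
   fusion rules for the components of a_1 in the 0- and 1/4-eigenspaces of a_0
   are linear equations for S S, a_0 (S S) and a_0 Y.  Their solution, compared with
   the one seen from a_1, puts a_3 into the span G of a_-2, ..., a_2, S, Y and
   s(a_0, a_2), and also shows (a_0, a_2) = (a_1, a_-1), since (a_0, a_1) >= 0.  The
   other products of elements of G follow from the fusion rules modulo G.

   For uniqueness the argument is run in B x B' with e, f replaced by (e, e'),
   (f, f'): the resulting span is the graph of the isomorphism, because the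
   difference of the two forms vanishes on it. *)

From HB Require Import structures.
Require Import Defs.
From mathcomp Require Import all_boot all_order all_algebra.
From mathcomp Require Import all_classical all_reals.
From mathcomp Require Import zify ring lra.

Set Implicit Arguments.
Unset Strict Implicit.
Unset Printing Implicit Defensive.

Import Order.TTheory GRing.Theory Num.Theory.
Local Open Scope classical_set_scope.
Local Open Scope ring_scope.

(** * Modes and gradings *)

(** The eight generators of G may be linearly dependent, as for e = f, and most products are only
    shown to lie in G, without coefficients. So there is no multiplication table from which an
    isomorphism could be defined; this is why the closure argument itself is run on pairs. In B x B'
    the pair (e, e') cannot simply be treated as an axis: the rule for two 1/4-eigenvectors involves
    the form, which may take different values in the two factors. That rule is therefore used in
    each factor separately. What it yields is recorded in [dihedral], a list of equations whose
    coefficients depend on l and m only, and closure is derived from this list alone. The equality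
    of (a_0, a_2) and (a_1, a_-1) is what makes two numbers enough. The form returns at the end.
    Associativity and invariance under the involutions reduce it on G to values on pairs of axes,
    and positivity makes both projections of the graph injective. *)

Section Binz.
Variable R : realType.
Implicit Type p : int.

Lemma binzn0 p : binz R p 0 = 1.
Proof. by rewrite /binz big_ord0 fact0 divr1. Qed.

Lemma binzn1 p : binz R p 1 = p%:~R.
Proof. by rewrite /binz big_ord1 /= subr0 divr1. Qed.

Lemma binz0S i : binz R 0 i.+1 = 0.
Proof. by rewrite /binz big_ord_recl /= subr0 mul0r mul0r. Qed.

Lemma binz_small (p i : nat) : (p < i)%N -> binz R p i = 0.
Proof.
by move=> pi; rewrite /binz (bigD1 (Ordinal pi)) //= subrr !mul0r.
Qed.

Lemma binzn3 p : binz R p 3 = p%:~R * (p%:~R - 1) * (p%:~R - 2) / 6.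
Proof.
by rewrite /binz !big_ord_recl big_ord0 /= /bump /= subr0 mulr1 !rmorphB mulrA.
Qed.

End Binz.

Section FiniteSum.
Variable M : nmodType.

Lemma fsum_ord (N : nat) (F : nat -> M) :
    (forall i, (N <= i)%N -> F i = 0) ->
  \sum_(i \in [set: nat]) F i = \sum_(i < N) F i.
Proof.
move=> F0; rewrite fsbig_ord; apply/esym/fsbig_widen => // i [_ /= /negP].
by rewrite -leqNgt => /F0.
Qed.

End FiniteSum.

Section Subspace.
Variables (R : realType) (M : lmodType R) (G : set M).
Hypothesis sG : subspace G.

Lemma subspace_D x y : G x -> G y -> G (x + y).
Proof. by case: sG => G0 GD Gx Gy; rewrite -[x]scale1r; apply: GD. Qed.

Lemma subspace_Z c x : G x -> G (c *: x).
Proof. by case: sG => G0 GD Gx; rewrite -[_ *: _]addr0; apply: GD. Qed.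

Lemma subspace_N x : G x -> G (- x).
Proof. by move=> Gx; rewrite -scaleN1r; apply: subspace_Z. Qed.

Lemma subspace_B x y : G x -> G y -> G (x - y).
Proof. by move=> Gx Gy; apply/subspace_D/subspace_N. Qed.

Lemma subspace_sum (I : Type) (r : seq I) (F : I -> M) :
  (forall i, G (F i)) -> G (\sum_(i <- r) F i).
Proof. by move=> GF; elim/big_rec: _ => [|i x _]; [case: sG|exact: subspace_D]. Qed.

End Subspace.

Section VoaBasics.
Variables (R : realType) (V : voa R).
Implicit Types (u v w x y : V) (n p q r k : int).

Lemma nprodDr n u v w : nprod n u (v + w) = nprod n u v + nprod n u w.
Proof. by have := nprod_linearr n u 1 v w; rewrite !scale1r. Qed.

Lemma nprod0r n u : nprod n u 0 = 0 :> V.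
Proof. by apply: (@addrI _ (nprod n u 0)); rewrite -nprodDr !addr0. Qed.

Lemma nprodZr n c u v : nprod n u (c *: v) = c *: nprod n u v.
Proof. by have := nprod_linearr n u c v 0; rewrite !addr0 nprod0r addr0. Qed.

Lemma nprodNr n u v : nprod n u (- v) = - nprod n u v.
Proof. by rewrite -scaleN1r nprodZr scaleN1r. Qed.

Lemma nprodBr n u v w : nprod n u (v - w) = nprod n u v - nprod n u w.
Proof. by rewrite nprodDr nprodNr. Qed.

Lemma nprodDl n u v w : nprod n (u + v) w = nprod n u w + nprod n v w.
Proof. by have := nprod_linearl n w 1 u v; rewrite !scale1r. Qed.

Lemma nprod0l n u : nprod n 0 u = 0 :> V.
Proof. by apply: (@addrI _ (nprod n 0 u)); rewrite -nprodDl !addr0. Qed.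

Lemma nprodZl n c u v : nprod n (c *: u) v = c *: nprod n u v.
Proof. by have := nprod_linearl n v c u 0; rewrite !addr0 nprod0l addr0. Qed.

Lemma nprodNl n u v : nprod n (- u) v = - nprod n u v.
Proof. by rewrite -scaleN1r nprodZl scaleN1r. Qed.

Lemma nprodBl n u v w : nprod n (u - v) w = nprod n u w - nprod n v w.
Proof. by rewrite nprodDl nprodNl. Qed.

Definition nprodE := (nprodBr, nprodBl, nprodDr, nprodDl, nprodNr, nprodNl,
  nprodZr, nprodZl, nprod0r, nprod0l).

(** The Borcherds identity with r = 0. Either factor may provide the cut-off: the binomials when p
    >= 0, the vanishing of u_(i) v otherwise. *)
Lemma commutator N p q u v w :
    (forall i, (N <= i)%N -> binz R p i = 0 \/ nprod i u v = 0) ->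
  nprod p u (nprod q v w) - nprod q v (nprod p u w) =
  \sum_(i < N) binz R p i *: nprod (p + q - i%:Z) (nprod i u v) w.
Proof.
move=> uv0; have := borcherds p q 0 u v w.
rewrite (@fsum_ord _ N) => [|i Ni]; last first.
  by rewrite add0r; case: (uv0 i Ni) => ->; rewrite ?scale0r ?nprod0l ?scaler0.
rewrite (@fsum_ord _ 1) => [|[//|i] _]; last by rewrite binz0S mulr0 scale0r.
rewrite big_ord1 /= binzn0 expr0 mulr1 scale1r expr0z scale1r. rewrite !addr0 => <-.
by apply: eq_bigr => i _; rewrite add0r.
Qed.

Lemma associator N q r u v w :
    (forall i, (N <= i)%N -> nprod i u w = 0) ->
    (forall i : nat, (N <= i)%N -> nprod (q + i) v w = 0) ->
  nprod q (nprod r u v) w =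
  \sum_(i < N) ((-1) ^+ i * binz R r i) *:
    (nprod (r - i%:Z) u (nprod (q + i%:Z) v w)
     - (-1) ^ r *: nprod (q + r - i%:Z) v (nprod i u w)).
Proof.
move=> uw0 vw0; have := borcherds 0 q r u v w.
rewrite (@fsum_ord _ 1) => [|[//|i] _]; last by rewrite binz0S scale0r.
rewrite big_ord1 binzn0 scale1r addr0 add0r subr0 => ->.
rewrite (@fsum_ord _ N) => [|i Ni]; first by apply: eq_bigr => i _; rewrite !add0r.
by rewrite add0r uw0 // vw0 // !nprod0r scaler0 subr0 scaler0.
Qed.

Lemma nprod_trunc_nat p u v :
  exists N, forall i : nat, (N <= i)%N -> nprod (p + i%:Z) u v = 0.
Proof.
have [N uv0] := nprod_trunc u v.
by exists `|N - p|%N => i iN; apply: uv0; lia.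
Qed.

(** The Borcherds identity at p = -1, q = 0, applied to the vacuum: modes of index >= 0 kill the
    vacuum, so one term survives on the right. *)
Lemma skew_symmetry N r u v :
    (forall i : nat, (N <= i)%N -> nprod (r + i%:Z) u v = 0) ->
  nprod r v u = (-1) ^ (r + 1) *: \sum_(i < N)
    binz R (-1) i *: nprod (- 1 - i%:Z) (nprod (r + i%:Z) u v) (vac V).
Proof.
move=> uv0; have := borcherds (-1) 0 r u v (vac V).
rewrite (@fsum_ord _ N) => [|i Ni]; last by rewrite uv0 // nprod0l scaler0.
rewrite (@fsum_ord _ 1) => [|[//|i] _]; last first.
  rewrite !nprod_vac_ge0 ?nprod0r ?scaler0 ?subr0 ?scaler0 //; lia.
rewrite big_ord1 /= binzn0 expr0 mulr1 scale1r nprod_vac_ge0 // nprod0r sub0r.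
rewrite (_ : -1 + 0%:Z = -1) // nprod_vacN1 (_ : 0 + r - 0%:Z = r); last by lia.
move=> ->; rewrite scalerN scalerA exprzDr ?unitrN1 // expr1z mulrN1.
by rewrite mulNr scaleNr opprK -exprzMl ?unitrN1 // mulN1r opprK exp1rz scale1r.
Qed.

End VoaBasics.

Section Grading.
Variables (R : realType) (V : voa R).
Implicit Types (u v w x y : V) (n p q r : int).

Lemma grade0 k : grade V k 0.
Proof. by have [] := grade_subspace V k. Qed.

Lemma gradeD k c u v : grade V k u -> grade V k v -> grade V k (c *: u + v).
Proof. by move=> uk vk; have [_] := grade_subspace V k; apply. Qed.

Lemma gradeZ k c u : grade V k u -> grade V k (c *: u).
Proof. by move=> uk; rewrite -[c *: u]addr0; apply/gradeD/grade0. Qed.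

Lemma gradeB k u v : grade V k u -> grade V k v -> grade V k (u - v).
Proof. by move=> uk vk; rewrite -scaleN1r addrC; apply: gradeD. Qed.

(** That modes respect the grading is not a field of [voa]. It is recovered from L(0), whose
    eigenvectors are homogeneous because the sum of the V_n is direct. *)
Lemma L0_eigen_grade u n : nprod 1 (conf V) u = n%:~R *: u ->
  u = 0 \/ exists2 k : nat, n = k & grade V k u.
Proof.
have [N [s [sgr ->]]] := grade_sum u.
pose t i : V := (i%:R - n%:~R) *: s i.
have tgr i : grade V i (t i) by apply: gradeZ.
move=> L0u; have t0 : \sum_(i < N) t i = 0.
  have L0s : nprod 1 (conf V) (\sum_(i < N) s i) = \sum_(i < N) i%:R *: s i.
    elim: N {L0u} => [|N IH]; first by rewrite !big_ord0 nprod0r.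
    by rewrite !big_ord_recr /= nprodDr IH (grade_L0 (sgr N)).
  rewrite L0s scaler_sumr in L0u; rewrite -[RHS](subrr (\sum_(i < N) i%:R *: s i)).
  by rewrite {2}L0u -sumrB; apply: eq_bigr => i _; rewrite /t scalerBl.
have {t0} st i : (i < N)%N -> i%:Z != n -> s i = 0.
  move=> iN ni; have /eqP := grade_direct tgr t0 iN.
  rewrite scaler_eq0 subr_eq0 => /orP[|/eqP //].
  by rewrite -[i%:R]/(i%:Z%:~R) eqr_int (negPf ni).
have [[k kn kN]|nk] := pselect (exists2 k : nat, n = k & (k < N)%N).
  right; exists k => //; rewrite (bigD1 (Ordinal kN)) //= big1 ?addr0 //.
  by move=> i /eqP ik; apply: st => //; rewrite kn; apply/eqP => -[ki]; apply/ik/val_inj.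
left; rewrite big1 // => i _; apply: st => //; apply/eqP => ni.
by apply: nk; exists i.
Qed.

Lemma L0_nprod n u v : nprod 1 (conf V) (nprod n u v) =
  nprod n u (nprod 1 (conf V) v) + nprod n (nprod 1 (conf V) u) v
  - (n + 1)%:~R *: nprod n u v.
Proof.
have := @commutator R V 2 1 n (conf V) u v.
move/(_ (fun i i1 => or_introl (binz_small R i1))).
rewrite !big_ord_recl big_ord0 /= addr0 /bump /= binzn0 binzn1 !scale1r LN1_deriv.
rewrite !addr0 (addrC 1 n) addrK => /eqP; rewrite subr_eq => /eqP ->.
by rewrite scaleNr -addrA [LHS]addrC [X in X - _]addrC.
Qed.

Lemma nprod_L0 k l n u v : grade V k u -> grade V l v ->
  nprod 1 (conf V) (nprod n u v) = (k%:Z + l%:Z - n - 1)%:~R *: nprod n u v.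
Proof.
move=> uk vl; rewrite L0_nprod (grade_L0 uk) (grade_L0 vl) nprodZr nprodZl.
by rewrite -scalerDl -scalerBl; congr (_ *: _); rewrite !rmorphB !rmorphD /=; ring.
Qed.

Lemma nprod_grade k l m n u v : grade V k u -> grade V l v ->
  k%:Z + l%:Z = n + 1 + m%:Z -> grade V m (nprod n u v).
Proof.
move=> uk vl klm; have [->|[j jm]] := L0_eigen_grade (nprod_L0 n uk vl).
  exact: grade0.
by rewrite (_ : j = m) //; lia.
Qed.

Lemma nprod_grade_lt0 k l n u v : grade V k u -> grade V l v ->
  k%:Z + l%:Z < n + 1 -> nprod n u v = 0.
Proof.
by move=> uk vl kln; have [//|[j jm]] := L0_eigen_grade (nprod_L0 n uk vl); lia.
Qed.

End Grading.

(* Symmetrizing the form spares the proof that an invariant form is symmetric: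
   only the adjoints of the modes of weight-two vectors are needed. *)
Definition adjoint_form (R : realType) (V : voa R) (b : V -> V -> R) : Prop :=
  [/\ forall u, scalar (b u),
      forall u v, b u v = b v u,
      forall v, v != 0 -> 0 < b v v,
      forall (n : int) (a u v : V), grade V 2 a ->
        b (nprod n a u) v = b u (nprod (2 - n) a v) &
      b (vac V) (vac V) = 1].

(** As L(1) a lies in V_1 = 0, only the term i = 0 of the invariance formula survives for a in
    V_2. *)
Lemma standing_adjoint_form (R : realType) (V : voa R) :
  standing V -> exists b : V -> V -> R, adjoint_form b.
Proof.
case=> V0 V1 [b [[br bl binv] b1 bpos]].
have L1 (a : V) : grade V 2 a -> nprod 2 (conf V) a = 0.
  move=> a2; have := @nprod_grade _ V 2 2 1 2 _ _ (grade_conf V) a2 erefl.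
  by rewrite V1.
have badj (n : int) (a u v : V) : grade V 2 a ->
    b (nprod n a u) v = b u (nprod (2 - n) a v).
  move=> a2; rewrite (binv 2) // !big_ord_recl big_ord0 /= /bump /= (L1 _ a2).
  rewrite !nprod0r !nprod0l sqrrN !expr1n fact0 invr1 !mul1r.
  have b0 x : b x 0 = 0.
    by have := br x (-1) 0 0; rewrite scaler0 addr0 mulN1r addNr.
  rewrite !b0 !mulr0 !addr0; congr (b _ (nprod _ _ _)); lia.
exists (fun u v => (b u v + b v u) / 2); split.
- by move=> u c x y; rewrite br bl; lra.
- by move=> u v; rewrite addrC.
- by move=> v /bpos v0; lra.
- move=> n a u v a2; rewrite badj // [b (nprod _ _ _) u]badj //.
  by rewrite opprB addrCA subrr addr0 addrC.
- by rewrite b1; lra.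
Qed.

(** * Positive-definite forms and orthogonal projection *)

Section BilinearForm.
Variables (R : realType) (M : lmodType R) (b : M -> M -> R).
Hypotheses (br : forall u, scalar (b u)) (bC : forall u v, b u v = b v u).
Hypothesis bpos : forall v, v != 0 -> 0 < b v v.

Lemma form_Dr u v w : b u (v + w) = b u v + b u w.
Proof. by have := br u 1 v w; rewrite scale1r mul1r. Qed.

Lemma form_0r u : b u 0 = 0.
Proof. by apply: (@addrI _ (b u 0)); rewrite -form_Dr !addr0. Qed.

Lemma form_Zr c u v : b u (c *: v) = c * b u v.
Proof. by have := br u c v 0; rewrite !addr0 form_0r addr0. Qed.

Lemma form_Nr u v : b u (- v) = - b u v.
Proof. by rewrite -scaleN1r form_Zr mulN1r. Qed.

Lemma form_Dl u v w : b (u + v) w = b u w + b v w.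
Proof. by rewrite bC form_Dr !(bC w). Qed.

Lemma form_0l u : b 0 u = 0.
Proof. by rewrite bC form_0r. Qed.

Lemma form_Zl c u v : b (c *: u) v = c * b u v.
Proof. by rewrite bC form_Zr (bC v). Qed.

Lemma form_Nl u v : b (- u) v = - b u v.
Proof. by rewrite bC form_Nr bC. Qed.

Definition formE := (form_Dr, form_Dl, form_Nr, form_Nl, form_Zr, form_Zl,
  form_0r, form_0l).

Lemma form_sumr I (r : seq I) (P : pred I) (F : I -> M) u :
  b u (\sum_(i <- r | P i) F i) = \sum_(i <- r | P i) b u (F i).
Proof. exact: (big_morph (b u) (form_Dr u) (form_0r u)). Qed.

Lemma form_eq0 v : b v v = 0 -> v = 0.
Proof. by move=> bv0; apply/eqP; apply: contraT => /bpos; rewrite bv0 ltxx. Qed.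

(** Pairing with an arbitrary z turns a vector identity into a scalar one, which [ring], [field] or
    [lra] can decide. *)
Lemma form_ext u v : (forall z, b u z = b v z) -> u = v.
Proof.
by move=> uv; apply/eqP; rewrite -subr_eq0; apply/eqP/form_eq0; rewrite form_Dl form_Nl uv subrr.
Qed.

(** No basis of S is at hand, only coordinates in an ambient family. By induction on d, S' is the
    part of S without the last coordinate, and one Gram-Schmidt step adds a vector s0 that has
    it. *)
Lemma orthogonal_projection d (B : nat -> M) (S : set M) : subspace S ->
    (forall x, S x -> exists c : nat -> R, x = \sum_(i < d) c i *: B i) ->
  forall v, exists2 s, S s & forall y, S y -> b (v - s) y = 0.
Proof.
elim: d S => [|d IH] S [S0 SD] SB v.
  by exists 0 => // y /SB [c ->]; rewrite big_ord0 form_0r.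
have SZ c x : S x -> S (c *: x) by move=> Sx; rewrite -[_ *: _]addr0; apply: SD.
pose S' := [set x | S x /\ exists c : nat -> R, x = \sum_(i < d) c i *: B i].
have subS' : subspace S'.
  split.
    by split=> //; exists (fun=> 0); rewrite big1 // => i _; rewrite scale0r.
  move=> k x y [Sx [c xE]] [Sy [c' yE]]; split; first exact: SD.
  exists (fun i => k * c i + c' i); rewrite {1}xE yE scaler_sumr -big_split /=.
  by apply: eq_bigr => i _; rewrite scalerA -scalerDl.
have IH' := IH S' subS' (fun x => @proj2 _ _).
have [[s0 [c [Ss0 s0E c0]]]|noS] := pselect (exists s0 (c : nat -> R),
    [/\ S s0, s0 = \sum_(i < d.+1) c i *: B i & c d != 0]); last first.
  apply: IH => // x Sx; have [c xE] := SB x Sx; exists c.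
  rewrite xE big_ord_recr /=; suff -> : c d = 0 by rewrite scale0r addr0.
  by apply/eqP; apply: contraT => c0; case: noS; exists x, c.
have [p S'p0 pE] := IH' s0; have [q [Sq _] qE] := IH' v.
have Sp : S p by case: S'p0.
pose t := s0 - p; pose r := b (v - q) t / b t t.
have St : S t by rewrite /t -scaleN1r addrC; apply: SD.
have rt : b (v - q) t = r * b t t.
  have [t0|t0] := eqVneq t 0; first by rewrite t0 !form_0r mulr0.
  by rewrite /r divfK // gt_eqF // bpos.
exists (r *: t + q); first exact: SD.
have S'0 z : S' z -> b (v - (r *: t + q)) z = 0.
  move=> S'z; have := qE _ S'z; have := pE _ S'z; rewrite -/t.
  by rewrite !formE => tz vz; rewrite tz; lra.
move=> y Sy; have [c' yE] := SB y Sy; pose k := c' d / c d.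
have S'y : S' (y - k *: s0).
  split; first by rewrite addrC -scaleNr; apply: SD.
  exists (fun i => c' i - k * c i); rewrite {1}yE {1}s0E !big_ord_recr /=.
  rewrite scalerDr opprD addrACA scalerA divfK // subrr addr0 scaler_sumr -sumrB.
  by apply: eq_bigr => i _; rewrite scalerA -scalerBl.
have S'p : S' (k *: p + (y - k *: s0)) by case: subS' => _; apply.
have -> : y = k *: t + (k *: p + (y - k *: s0)).
  by rewrite /t scalerBr addrA subrK addrCA subrr addr0.
rewrite form_Dr (S'0 _ S'p) addr0 form_Zr; apply/eqP; rewrite mulf_eq0; apply/orP; right.
by apply/eqP; rewrite !formE in rt *; lra.
Qed.

End BilinearForm.

(** * Modes of weight-two vectors and the Virasoro relations of a conformal vector *)

Section Weight2.
Variables (R : realType) (V : voa R) (b : V -> V -> R).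
Hypotheses (hV : standing V) (hb : adjoint_form b).
Implicit Types (a u v w x y : V) (n p q r k : int).

Let br : forall u, scalar (b u). Proof. by case: hb. Qed.
Let bC : forall u v, b u v = b v u. Proof. by case: hb. Qed.
Let bpos : forall v, v != 0 -> 0 < b v v. Proof. by case: hb. Qed.
Let bE := formE br bC.

Lemma adjoint_mode n a u v : grade V 2 a -> b (nprod n a u) v = b u (nprod (2 - n) a v).
Proof. by case: hb => _ _ _ + _; apply. Qed.

Lemma weight2_mode2 x y : grade V 2 x -> grade V 2 y -> nprod 2 x y = 0.
Proof.
move=> x2 y2; have := @nprod_grade _ V 2 2 1 2 _ _ x2 y2 erefl.
by case: hV => _ -> _.
Qed.

(** The scalar is found by pairing with the vacuum, as x = x_(-1) 1 and x_(3) is the adjoint of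
    x_(-1). *)
Lemma weight2_mode3 x y : grade V 2 x -> grade V 2 y ->
  nprod 3 x y = b x y *: vac V.
Proof.
move=> x2 y2; have := @nprod_grade _ V 2 2 0 3 _ _ x2 y2 erefl.
case: (hV) => -> _ _ [r xyr]; rewrite xyr; congr (_ *: _).
have := @adjoint_mode (-1) x (vac V) y x2; rewrite nprod_vacN1 => ->.
rewrite (_ : 2 - -1 = 3) // xyr form_Zr //.
by case: hb => _ _ _ _ ->; rewrite mulr1.
Qed.

Lemma weight2_mode_ge4 x y n : grade V 2 x -> grade V 2 y -> 4 <= n -> nprod n x y = 0.
Proof. by move=> x2 y2 n4; apply: nprod_grade_lt0 x2 y2 _; lia. Qed.

Lemma griess_form_adjoint x y : grade V 2 x -> grade V 2 y -> griess_form x y = b x y.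
Proof.
move=> x2 y2; rewrite /griess_form; apply: xget_unique; first exact: weight2_mode3.
move=> r /=; rewrite weight2_mode3 // => xyr.
have := congr1 (b (vac V)) xyr; rewrite !form_Zr //.
by case: hb => _ _ _ _ ->; rewrite !mulr1.
Qed.

Lemma griess_mulC x y : grade V 2 x -> grade V 2 y -> nprod 1 x y = nprod 1 y x.
Proof.
move=> x2 y2; rewrite (@skew_symmetry R V 3 1 y x) => [|i i3]; last first.
  by apply: weight2_mode_ge4 => //; lia.
rewrite !big_ord_recl big_ord0 /= /bump /= binzn0 !scale1r !addr0.
rewrite (_ : 1%:Z + (1 + 0)%N%:Z = 2) // weight2_mode2 //.
rewrite (_ : 1%:Z + (1 + (1 + 0))%N%:Z = 3) // weight2_mode3 //.
rewrite !nprodE vac_nprod /= !scaler0 !addr0 nprod_vacN1.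
by rewrite -exprnP sqrrN expr1n scale1r.
Qed.

Section Conformal.
Variable a : V.
Hypothesis ha : conformal_vector (1 / 2%:R) a.

Let a2 : grade V 2 a. Proof. by case: ha. Qed.
Let aa1 : nprod 1 a a = 2%:R *: a. Proof. by case: ha. Qed.
Let aa3 : nprod 3 a a = 4%:R^-1 *: vac V.
Proof. by case: ha => _ _ ->; congr (_ *: _); lra. Qed.

Lemma conformal_form : b a a = 4^-1.
Proof.
have := congr1 (b (vac V)) aa3; rewrite weight2_mode3 // !form_Zr //.
by case: hb => _ _ _ _ ->; rewrite !mulr1.
Qed.

(** Skew-symmetry gives a_(0) a = - a_(0) a + 2 a_(-2) 1, and a_(-2) 1 = L(-1) a. *)
Lemma conformal_mode0 : nprod 0 a a = nprod 0 (conf V) a.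
Proof.
have aD : nprod 0 (conf V) a = nprod (-2) a (vac V).
  by rewrite -[LHS]nprod_vacN1 LN1_deriv -mulrNz scale1r.
rewrite aD; suff : nprod 0 a a = - nprod 0 a a + 2%:R *: nprod (-2) a (vac V).
  move=> /eqP; rewrite -subr_eq0 opprD opprK addrA -mulr2n -scaler_nat -scalerBr.
  by rewrite scaler_eq0 pnatr_eq0 /= subr_eq0 => /eqP.
rewrite {1}(@skew_symmetry R V 4 0 a a) => [|i i4]; last first.
  by apply: weight2_mode_ge4 => //; lia.
rewrite !big_ord_recl big_ord0 /= /bump /= binzn0 !scale1r !addr0 binzn1.
rewrite (_ : 0%:Z + (1 + 0)%N%:Z = 1) // aa1.
rewrite (_ : 0%:Z + (1 + (1 + 0))%N%:Z = 2) // weight2_mode2 //.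
rewrite (_ : 0%:Z + (1 + (1 + (1 + 0)))%N%:Z = 3) // aa3.
rewrite !nprodE vac_nprod /= !scaler0 !addr0 nprod_vacN1.
by rewrite expr1z !scaleN1r opprD opprK.
Qed.

Lemma virasoro_mode m n v : nprod m a (nprod n a v) =
  nprod n a (nprod m a v) + ((m - n)%:~R *: nprod (m + n - 1) a v
  + (if m + n == 2 then ((m - 1) ^+ 3 - (m - 1))%:~R / 24 else 0) *: v).
Proof.
apply/eqP; rewrite addrC -subr_eq; apply/eqP.
rewrite (@commutator R V 4) => [|i i4]; last by right; apply: weight2_mode_ge4.
rewrite !big_ord_recl big_ord0 /= /bump /= binzn0 !scale1r !addr0 binzn1.
rewrite weight2_mode2 // aa1 aa3 conformal_mode0 LN1_deriv !nprodE scaler0 add0r.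
rewrite vac_nprod addrA scalerA -scalerDl; congr (_ *: _ + _).
  by rewrite !rmorphB !rmorphD /=; ring.
rewrite binzn3; case: eqP => [mn|mn]; case: eqP => [mn2|mn2]; try lia; last first.
  by rewrite !scaler0 scale0r.
by rewrite scalerA; congr (_ *: _); rewrite !rmorphB rmorphXn rmorphB /=; field.
Qed.

End Conformal.
End Weight2.

(** * Highest weight vectors of an Ising vector *)

Section IsingVector.
Variables (R : realType) (V : voa R) (b : V -> V -> R).
Hypotheses (hV : standing V) (hb : adjoint_form b).
Variable a : V.
Hypothesis ha : conformal_vector (1 / 2%:R) a.
Implicit Types (u v w x y : V) (n p q r k : int).

Let br : forall u, scalar (b u). Proof. by case: hb. Qed.
Let bC : forall u v, b u v = b v u. Proof. by case: hb. Qed.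
Let bpos : forall v, v != 0 -> 0 < b v v. Proof. by case: hb. Qed.
Let bE := formE br bC.
Let a2 : grade V 2 a. Proof. by case: ha. Qed.
Let adj n u v : b (nprod n a u) v = b u (nprod (2 - n) a v).
Proof. exact: adjoint_mode. Qed.

(** The side conditions are integer equations that hold by computation, so [vir_step] can supply k,
    d and c by evaluation. *)
Lemma virasoro_mode_at m n k d c v : m + n - 1 = k -> m - n = d ->
    (if m + n == 2 then (m - 1) ^+ 3 - (m - 1) else 0) = c ->
  nprod m a (nprod n a v) = nprod n a (nprod m a v) +
    (d%:~R *: nprod k a v + (c%:~R / 24) *: v).
Proof.
move=> <- <- <-; rewrite (virasoro_mode hV ha); congr (_ + (_ + _ *: _)).
by case: ifP; rewrite // mul0r.
Qed.

Ltac vir_step :=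
  match goal with |- context [nprod (Posz ?m) a (nprod ?n a ?x)] =>
    let t := eval vm_compute in ((n <= 0) && (n < Posz m))%R in
    match t with true =>
    let k := eval vm_compute in (Posz m + n - 1 :> int)%R in
    let d := eval vm_compute in (Posz m - n :> int)%R in
    let c := eval vm_compute in
      (if Posz m + n == 2 :> int then (Posz m - 1) ^+ 3 - (Posz m - 1) else 0 :> int)%R in
    rewrite (@virasoro_mode_at (Posz m) n k d c x erefl erefl erefl)
    end
  end.

Lemma mode_vac (i : nat) : nprod i a (vac V) = 0.
Proof. exact: nprod_vac_ge0. Qed.

(* The singular vector of weight 6 for central charge 1/2; L(- n) is the mode
   1 - n of a, and the constructors Posz and Negz are what [vir_step] computes. *)
Definition null6 : V :=
  64 *: nprod (Negz 0) a (nprod (Negz 0) a (nprod (Negz 0) a (vac V)))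
  + 93 *: nprod (Negz 1) a (nprod (Negz 1) a (vac V))
  - 264 *: nprod (Negz 2) a (nprod (Negz 0) a (vac V))
  - 108 *: nprod (Negz 4) a (vac V).

Ltac vir_vac :=
  repeat (vir_step; rewrite ?nprodE); rewrite ?mode_vac ?nprodE;
   apply: (form_ext br bC bpos) => z; rewrite !bE; lra.

(** The indices 3, 4, 5, 7 are 2 - n for the outermost modes n of [null6]; its norm involves no
    others. *)
Lemma null6_lower :
  [/\ nprod (Posz 3) a null6 = 0, nprod (Posz 4) a null6 = 0,
      nprod (Posz 5) a null6 = 0 & nprod (Posz 7) a null6 = 0].
Proof. by split; rewrite /null6 !nprodE; vir_vac. Qed.

Lemma null6_eq0 : null6 = 0.
Proof.
apply: (form_eq0 bpos); case: null6_lower; move: {1 2 3 4 6}null6 => z L2 L3 L4 L6.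
rewrite /null6 !bE !(adj _ _ z).
rewrite (_ : 2 - Negz 0 = Posz 3) // (_ : 2 - Negz 1 = Posz 4) //.
rewrite (_ : 2 - Negz 2 = Posz 5) // (_ : 2 - Negz 4 = Posz 7) //.
by rewrite L2 L3 L4 L6 !bE; ring.
Qed.

(** Both a_(0) and L(-1) are derivations of all products, and they agree on the generator a. *)
Lemma vir_mode0 u : vir a u -> nprod 0 a u = nprod 0 (conf V) u.
Proof.
move: u; pose W := [set x | nprod 0 a x = nprod 0 (conf V) x].
have deriv u n x y : nprod 0 u (nprod n x y) =
    nprod n (nprod 0 u x) y + nprod n x (nprod 0 u y).
  have := @commutator R V 1 0 n u x y.
  move/(_ (fun i i1 => or_introl (binz_small R i1))).
  rewrite big_ord1 binzn0 scale1r add0r subr0 => /(canRL (subrK _)) ->.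
  by rewrite addrC.
apply: (@smallest_sub _ _ _ W) => [|y ->]; last exact: (conformal_mode0 hV ha).
split; first by split=> [|c u v uW vW]; rewrite /W /= !nprodE // uW vW.
  by rewrite /W /= !nprod_vac_ge0.
by move=> n u v uW vW; rewrite /W /= !deriv uW vW.
Qed.

(* L^a(k) v = 0 for k > 0, where L^a(k) = a_(k + 1). *)
Definition singular (v : V) := forall k : int, 2 <= k -> nprod k a v = 0.

(** In the associator formula, terms with a mode of a on the outside vanish against w, since the
    adjoint mode has index >= 2. In the others v is killed by a_(i) for i >= 2, so only i = 0, 1
    remain. *)
Lemma singular_mode_sum w v x n p : singular v -> singular w -> p <= 0 ->
  b w (nprod n (nprod p a x) v) = - (-1) ^ p *
    (b w (nprod (n + p) x (nprod 0 a v)) -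
     p%:~R * b w (nprod (n + p - 1) x (nprod 1 a v))).
Proof.
move=> sv sw p0; have [N1 xv] := nprod_trunc_nat n x v.
rewrite (@associator R V N1.+2 n p a x v); first last.
- by move=> i iN; apply: xv; lia.
- by move=> i iN; apply: sv; lia.
have wa k y : k <= 0 -> b w (nprod k a y) = 0.
  move=> k0; rewrite (_ : k = 2 - (2 - k)) -?adj ?sw ?form_0l //; lia.
rewrite form_sumr // 2!big_ord_recl big1 => [|i _]; last first.
  by rewrite !bE wa ?sv ?nprod0r ?bE ?mulr0 ?subr0 ?mulr0 //=; rewrite /bump; lia.
rewrite /= /bump /= !bE !wa; [|lia..].
rewrite binzn0 binzn1 !subr0 addn0 expr1 expr0; ring.
Qed.

Lemma singular_mode0 v w x k : singular w ->
  b w (nprod k x (nprod 0 a v)) = - b w (nprod k (nprod 0 a x) v).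
Proof.
move=> sw; have := @commutator R V 1 0 k a x v.
move/(_ (fun i i1 => or_introl (binz_small R i1))).
rewrite big_ord1 binzn0 scale1r add0r subr0 => <-.
by rewrite !bE -(adj 2) sw // !bE; ring.
Qed.

Lemma singularD c u v : singular u -> singular v -> singular (c *: u + v).
Proof. by move=> su sv k k2; rewrite !nprodE su // sv // scaler0 addr0. Qed.

Lemma singular0 : singular 0.
Proof. by move=> k _; rewrite nprod0r. Qed.

Lemma singularZ c u : singular u -> singular (c *: u).
Proof. by move=> su; rewrite -[_ *: _]addr0; apply/singularD/singular0. Qed.

Lemma singular_L0 v : singular v -> singular (nprod 1 a v).
Proof.
move=> sv k k2; rewrite (virasoro_mode hV ha) sv // nprod0r add0r.
rewrite (_ : k + 1 - 1 = k) ?sv //; last by lia.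
by rewrite (_ : (k + 1 == 2) = false) ?scaler0 ?scale0r ?addr0 //; apply/eqP; lia.
Qed.

(** A creation mode of the inserted vector is traded for a shift of the index and a factor L^a(0) on
    v; repetition evaluates the modes of [null6]. *)
Lemma vir_mode_sum v w x n p : singular v -> singular w -> p <= 0 -> vir a x ->
  b w (nprod n (nprod p a x) v) = - (-1) ^ p *
    ((n + p)%:~R * b w (nprod (n + p - 1) x v) -
     p%:~R * b w (nprod (n + p - 1) x (nprod 1 a v))).
Proof.
move=> sv sw p0 ax; rewrite singular_mode_sum //.
by rewrite singular_mode0 // vir_mode0 // LN1_deriv !bE; ring.
Qed.

(* The zero mode of the null vector acts on singular vectors as
   2 h (2 h - 1) (16 h - 1) in h = L^a(0). *)
Lemma singular_minpoly v : singular v ->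
  32 *: nprod 1 a (nprod 1 a (nprod 1 a v)) - 18 *: nprod 1 a (nprod 1 a v)
  + nprod 1 a v = 0.
Proof.
move=> sv; set L := nprod 1 a.
have sL y : singular y -> singular (L y) by exact: singular_L0.
have v1 : vir a (vac V) by move=> W [[_ + _] _].
have va : vir a a by move=> W [_]; apply.
have vm n x : vir a x -> vir a (nprod n a x).
  move=> vx W WP; have [[_ _ Wm] Wa] := WP; apply: Wm; [exact: Wa|exact: vx].
(* Only pairings with singular w can be evaluated. This suffices, as the vector q below is itself
   singular. *)
have b0 w : singular w -> b w (64 *: L (L (L v)) - 36 *: L (L v) + 2 *: L v) = 0.
  move=> sw; have /(congr1 (fun x => b w (nprod 5 x v))) := null6_eq0.
  rewrite /null6 (_ : Negz 0 = -1) // (_ : Negz 1 = -2) //.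
  rewrite (_ : Negz 2 = -3) // (_ : Negz 4 = -5) //.
  have F n p k x y : singular y -> vir a x -> p <= 0 -> k = n + p - 1 ->
      b w (nprod n (nprod p a x) y) = - (-1) ^ p *
      ((n + p)%:~R * b w (nprod k x y) - p%:~R * b w (nprod k x (L y))).
    by move=> sy ax p0 ->; exact: vir_mode_sum.
  rewrite !nprodE !bE.
  rewrite (F 5 (-1) 3) ?(F 3 (-1) 1) ?nprod_vacN1; auto.
  rewrite (F 5 (-2) 2) ?(F 2 (-2) (-1)); auto.
  rewrite (F 5 (-3) 1); auto.
  rewrite (F 5 (-5) (-1)); auto.
  have sgn (k : nat) : (-1) ^ (- k%:Z) = (-1) ^+ odd k :> R.
    by rewrite signr_odd -invr_expz -exprnP -exprVn invrN1.
  rewrite !vac_nprod /= (sgn 1%N) (sgn 2%N) (sgn 3%N) (sgn 5%N) /= expr0 expr1 -/L; lra.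
set q := LHS; have qE : q = 2^-1 *: (64 *: L (L (L v)) - 36 *: L (L v) + 2 *: L v).
  by apply: (form_ext br bC bpos) => z; rewrite /q !bE; field.
have sq : singular q.
  by rewrite /q -scaleNr -addrA; do 2![apply: singularD; auto].
by apply: (form_eq0 bpos); rewrite {2}qE (form_Zr br) b0 ?mulr0.
Qed.

Definition hw (h : R) (v : V) := singular v /\ nprod 1 a v = h *: v.

(** The components are the Lagrange polynomials of the roots 0, 1/2, 1/16 in L^a(0), which preserves
    each V_m. *)
Lemma singular_decomp v : singular v -> exists v0 v1 v2,
  [/\ v = v0 + v1 + v2, hw 0 v0, hw (1 / 2) v1, hw (1 / 16) v2 &
      forall m : nat, grade V m v -> [/\ grade V m v0, grade V m v1 & grade V m v2]].
Proof.
move=> sv; have := singular_minpoly sv; set L := nprod 1 a => L3.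
have sL y : singular y -> singular (L y) by exact: singular_L0.
have gL (k : nat) y : grade V k y -> grade V k (L y).
  by move=> yk; apply: (nprod_grade a2 yk); lia.
have {}L3 : L (L (L v)) = (18 / 32) *: L (L v) - 32^-1 *: L v.
  apply: (form_ext br bC bpos) => z; have := congr1 (b ^~ z) L3.
  by rewrite /= !bE; lra.
exists (32 *: L (L v) + (- 18 *: L v + v)).
exists ((32 / 7) *: L (L v) + (- (2 / 7)) *: L v).
exists ((- (256 / 7)) *: L (L v) + (128 / 7) *: L v); split.
- by apply: (form_ext br bC bpos) => z; rewrite !bE; field.
- split; first by (apply: singularD; [auto|apply: singularD; auto]).
  by rewrite -/L /L !nprodE -/L L3; apply: (form_ext br bC bpos) => z; rewrite !bE; field.
- split; first by (apply: singularD; [auto|apply: singularZ; auto]).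
  by rewrite -/L /L !nprodE -/L L3; apply: (form_ext br bC bpos) => z; rewrite !bE; field.
- split; first by (apply: singularD; [auto|apply: singularZ; auto]).
  by rewrite -/L /L !nprodE -/L L3; apply: (form_ext br bC bpos) => z; rewrite !bE; field.
- move=> k vk; split; apply: gradeD; auto; last exact: gradeZ (gL _ _ vk).
  + by apply: gradeD; auto.
  + exact: gradeZ (gL _ _ vk).
Qed.

Lemma hw_mode_eq0 h k u : hw h u -> 2 <= k -> nprod k a u = 0.
Proof. by move=> [su _]; exact: su. Qed.

(** The squared norm of L^a(-1) u is 2 h times that of u. *)
Lemma hw0_mode0 u : hw 0 u -> nprod 0 a u = 0.
Proof.
move=> hu; apply: (form_eq0 bpos); rewrite adj.
rewrite (@virasoro_mode_at (2 - 0) 0 1 2 0 u erefl erefl erefl).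
by rewrite (hw_mode_eq0 hu) // (proj2 hu) mul0r !scale0r !nprodE scaler0 !addr0 !bE.
Qed.

(* The difference of the two sides has norm zero. *)
Lemma hw_null2 h u : (4 * h + 4^-1) * (4 * h + 2) = 18 * h -> hw h u ->
  nprod (-1) a u = (3 / (4 * h + 2)) *: nprod 0 a (nprod 0 a u).
Proof.
move=> hh hu; have h2 : 4 * h + 2 != 0 by apply/eqP => h2; move: hh; rewrite h2; lra.
set x := (RHS); apply/eqP; rewrite -subr_eq0; apply/eqP.
set y := (LHS).
have uk (k : nat) : nprod k.+2 a u = 0 by exact: hw_mode_eq0 hu _.
have u1 : nprod (Posz 1) a u = h *: u by case: hu.
have yE : y = nprod (Negz 0) a u -
    (3 / (4 * h + 2)) *: nprod (Posz 0) a (nprod (Posz 0) a u) by [].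
have L1 : nprod (Posz 2) a y = 0.
  rewrite yE !nprodE; do ![vir_step; rewrite ?nprodE].
   rewrite !uk u1 !nprodE; apply: (form_ext br bC bpos) => z; rewrite !bE.
  by field.
(* The hypothesis on h enters here: up to a factor 2 h it is the vanishing of the level-two Gram
   determinant for central charge 1/2. *)
have L2 : nprod (Posz 3) a y = 0.
  rewrite yE !nprodE; do ![vir_step; rewrite ?nprodE].
  rewrite !uk u1 !nprodE; apply: (form_ext br bC bpos) => z; rewrite !bE.
  suff : (4 * h + 4^-1 - 18 * h / (4 * h + 2)) * b u z = 0.
    by move=> E; rewrite -[RHS]E; field.
  by rewrite -hh mulfK // subrr mul0r.
apply: (form_eq0 bpos); rewrite {1}yE; clearbody y.
rewrite !bE ![b (nprod _ _ _) y]adj.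
rewrite (_ : 2 - Negz 0 = Posz 3) // (_ : 2 - Posz 0 = Posz 2) // L1 L2 !bE; ring.
Qed.

(* If the null vector of [hw0_mode0] or [hw_null2] for h1 = h(u) is inserted in a
   three-point function <w, Y(u, z) v> of highest weight vectors, the function is
   multiplied by a polynomial in the weights; it must not vanish. *)
Definition forbidden (h1 h2 h3 : R) : Prop :=
  let c := h3 - h2 - h1 in
  h1 = 0 /\ c <> 0 \/
  (4 * h1 + 4^-1) * (4 * h1 + 2) = 18 * h1 /\
    (h2 - c) * (4 * h1 + 2) - 3 * (c * (c - 1)) <> 0.

(** Evaluate the commutator of a_(1) and x_(n - 1) between the L^a(0)-eigenvectors w and v. *)
Lemma mode0_weight h2 h3 g v w x n : hw h2 v -> hw h3 w -> nprod 1 a x = g *: x ->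
  b w (nprod n (nprod 0 a x) v) = (h3 - h2 - g) * b w (nprod (n - 1) x v).
Proof.
move=> [sv v2] [sw w3] xg; have := @commutator R V 2 1 (n - 1) a x v.
move/(_ (fun i i1 => or_introl (binz_small R i1))).
rewrite !big_ord_recl big_ord0 /= /bump /= binzn0 binzn1 !scale1r !addr0.
rewrite (addrC 1) subrK (_ : (1 + 0)%N = 1%N) // xg v2 => /(congr1 (b w)).
rewrite !nprodE !bE -(adj 1) w3 !bE => xE.
by rewrite -[LHS](addrK (g * b w (nprod (n - 1) x v))) -xE; ring.
Qed.

Lemma fusion_eq0 h1 h2 h3 u v w n : forbidden h1 h2 h3 ->
  hw h1 u -> hw h2 v -> hw h3 w -> b w (nprod n u v) = 0.
Proof.
move=> fb hu hv hw3; have [su u1] := hu; have [sv v2] := hv; have [sw w3] := hw3.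
have M0 := mode0_weight _ hv hw3.
case: fb => [[h10 /eqP c0]|[null /eqP c0]].
  rewrite h10 in hu u1 c0; have := M0 0 u (n + 1) u1.
  rewrite addrK hw0_mode0 // !(nprodE, bE) => /esym/eqP.
  by rewrite mulf_eq0 (negPf c0) => /eqP.
have := congr1 (fun x => b w (nprod (n + 2) x v)) (hw_null2 null hu).
rewrite singular_mode_sum // !nprodE !bE singular_mode0 //.
have u01 : nprod 1 a (nprod 0 a u) = (h1 + 1) *: nprod 0 a u.
  rewrite (@virasoro_mode_at 1 0 0 1 0 u erefl erefl erefl).
  by rewrite u1 !nprodE mul0r !scale0r addr0 scalerDl scale1r.
rewrite (M0 _ _ _ u01) !(M0 _ _ _ u1) v2 !nprodE bE.
rewrite exprN1 invrN1 (_ : n + 2 - 1 - 1 = n) => [/eqP|]; last by lia.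
rewrite -subr_eq0 => /eqP E; apply/eqP; move: c0; apply: contraNT => nz.
have d0 : 4 * h1 + 2 != 0 by apply/eqP => d0; move: null; rewrite d0; lra.
rewrite -(inj_eq (mulIf nz)) mul0r; apply/eqP.
by rewrite -[RHS](mulr0 (4 * h1 + 2)) -E; field.
Qed.

(** * Fusion rules and the involution tau *)

(** The mode - n of a is L^a(- n - 1), so the index is the level of the descendant; the modes come
    in any order. *)
Inductive word (P : V -> Prop) : nat -> V -> Prop :=
| word0 v : P v -> word P 0 v
| wordS (k n : nat) x : word P k x -> word P (k + n.+1) (nprod (- n%:Z) a x).

(* The Virasoro submodule generated by the set P of highest weight vectors. *)
Inductive desc (P : V -> Prop) : V -> Prop :=
| desc0 : desc P 0
| descD c (k : nat) x y : word P k x -> desc P y -> desc P (c *: x + y).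

Lemma desc_word P (k : nat) x : word P k x -> desc P x.
Proof.
move=> wx; have := descD 1 wx (desc0 P).
by rewrite scale1r addr0.
Qed.

Lemma desc_lin P c x y : desc P x -> desc P y -> desc P (c *: x + y).
Proof.
move=> dx dy; elim: dx c => [|d k u v wu dv IH] c; first by rewrite scaler0 add0r.
by rewrite scalerDr scalerA -addrA; exact: descD wu (IH c).
Qed.

Lemma descZ P c x : desc P x -> desc P (c *: x).
Proof. by move=> dx; rewrite -[_ *: _]addr0; apply/desc_lin/desc0. Qed.

Lemma desc_subspace P : subspace (desc P).
Proof. by split; [exact: desc0|exact: desc_lin]. Qed.

Lemma desc_create P (n : nat) x : desc P x -> desc P (nprod (- n%:Z) a x).
Proof.
elim=> [|c k u y wu dy IH]; first by rewrite nprod0r; exact: desc0.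
by rewrite !nprodE; apply: desc_lin IH; apply: desc_word (wordS n wu).
Qed.

Lemma desc_mode P h : (forall v, P v -> hw h v) ->
  forall k x, desc P x -> desc P (nprod k a x).
Proof.
move=> Ph; have wm (j : nat) u : word P j u -> forall k, desc P (nprod k a u).
  elim=> [v Pv k|i n x wx IH k].
    have dv := desc_word (word0 Pv); have [sv v1] := Ph _ Pv.
    have [k0|k0] := lerP k 0.
      by rewrite (_ : k = - `|k|%N%:Z); [apply: desc_create|lia].
    have [k2|k2] := lerP 2 k; first by rewrite sv //; exact: desc0.
    by rewrite (_ : k = 1) ?v1; [exact: descZ|lia].
  rewrite (virasoro_mode hV ha) addrC; rewrite -addrA.
  apply: desc_lin (IH _) _; apply: desc_lin (desc_word wx) _.
  exact/desc_create/IH.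
move=> k x; elim=> [|c j u y wu dy IH]; first by rewrite nprod0r; exact: desc0.
by rewrite !nprodE; apply: desc_lin IH; exact: wm wu _.
Qed.

Lemma desc_hw_mode h k x : desc (hw h) x -> desc (hw h) (nprod k a x).
Proof. exact: (@desc_mode _ h). Qed.

Lemma word_weight P h (k : nat) x : (forall v, P v -> hw h v) -> word P k x ->
  nprod 1 a x = (h + k%:R) *: x.
Proof.
move=> Ph; elim=> [v /Ph [_ ->]|j n y wy IH]; first by rewrite addr0.
rewrite (virasoro_mode hV ha) IH nprodZr opprK.
rewrite (_ : 1 + - n%:Z - 1 = - n%:Z); last by lia.
rewrite (_ : (1 + - n%:Z == 2) = false) ?scale0r ?addr0 -?scalerDl; last by apply/eqP; lia.
congr (_ *: _); rewrite rmorphD /= natrD -[n.+1%:R]natr1; ring.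
Qed.

(* Induction on the descendant u of a singular vector, next on w, finally on v. *)
Lemma desc_fusion h1 h2 h3 u v w n : forbidden h1 h2 h3 ->
  desc (hw h1) u -> desc (hw h2) v -> desc (hw h3) w -> b w (nprod n u v) = 0.
Proof.
move=> fb.
have step1 (k : nat) x : word (hw h1) k x -> forall v w, hw h2 v -> hw h3 w ->
    forall n, b w (nprod n x v) = 0.
  elim=> [x' hx|j m y wy IH] v' w' hv hw' n'; first exact: (fusion_eq0 _ fb hx hv hw').
  have [sv v2] := hv; have [sw _] := hw'.
  rewrite singular_mode_sum //; last by lia.
  rewrite singular_mode0 //.
  rewrite (mode0_weight _ hv hw' (word_weight (fun _ => id) wy)) // v2.
  by rewrite nprodZr (form_Zr br) !IH //; ring.
have step1' x : desc (hw h1) x -> forall v w, hw h2 v -> hw h3 w ->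
    forall n, b w (nprod n x v) = 0.
  move=> dx v' w' hv hw' n'; elim: dx => [|c k y z wy _ IH].
    by rewrite nprod0l bE.
  by rewrite !nprodE !bE IH (step1 _ _ wy) // mulr0 addr0.
(* Once z pairs to zero with all x_(n) y, the commutator terms vanish too, and a mode of a may be
   moved across x. *)
have comm p q x y z : desc (hw h1) x ->
    (forall x, desc (hw h1) x -> forall n, b z (nprod n x y) = 0) ->
    b z (nprod p a (nprod q x y)) = b z (nprod q x (nprod p a y)).
  move=> dx H; have [N ax0] := nprod_trunc_nat 0 a x.
  have ax i : (N <= i)%N -> binz R p i = 0 \/ nprod i a x = 0.
    by move=> iN; right; have := ax0 i iN; rewrite add0r.
  have /(congr1 (b z)) := commutator q y ax.
  rewrite (form_sumr br) big1 => [|i _]; last first.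
    by rewrite (form_Zr br) H ?mulr0 //; exact: desc_hw_mode.
  by rewrite !bE => /eqP; rewrite subr_eq0 => /eqP.
have step2 (k : nat) z : word (hw h3) k z -> forall x v, desc (hw h1) x -> hw h2 v ->
    forall n, b z (nprod n x v) = 0.
  elim=> [z' hz|j m y wy IH] x v' dx hv n'; first exact: step1'.
  rewrite adj opprK comm // => [|x' dx' k']; last exact: IH.
  by have [sv _] := hv; rewrite sv ?nprod0r ?bE //; lia.
have step2' z : desc (hw h3) z -> forall x v, desc (hw h1) x -> hw h2 v ->
    forall n, b z (nprod n x v) = 0.
  move=> dz x v' dx hv n'; elim: dz => [|c k y t wy _ IH]; first by rewrite bE.
  by rewrite !bE IH (step2 _ _ wy) // mulr0 addr0.
have step3 (k : nat) y : word (hw h2) k y -> forall x z, desc (hw h1) x -> desc (hw h3) z ->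
    forall n, b z (nprod n x y) = 0.
  elim=> [y' hy|j m y' wy IH] x z dx dz n'; first exact: step2'.
  rewrite -comm // => [|x' dx' k']; last exact: IH.
  by rewrite -[- m%:Z](subKr 2) -adj IH //; exact: desc_hw_mode.
move=> du dv dw; elim: dv => [|c k y t wy _ IH]; first by rewrite nprod0r bE.
by rewrite !nprodE !bE IH (step3 _ _ wy) // mulr0 addr0.
Qed.

Lemma desc_orthogonal h h' x y : (forall k l : nat, h + k%:R <> h' + l%:R) ->
  desc (hw h) x -> desc (hw h') y -> b x y = 0.
Proof.
move=> hh' dx dy; elim: dx => [|c k u v wu _ IHx]; first by rewrite bE.
rewrite !bE IHx addr0; elim: dy => [|c' l u' v' wu' _ IHy]; first by rewrite bE mulr0.
rewrite !bE mulrDr IHy addr0; suff -> : b u u' = 0 by rewrite !mulr0.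
have := adj 1 u u'; rewrite (word_weight (fun _ => id) wu) (_ : 2 - 1 = 1) //.
rewrite (word_weight (fun _ => id) wu') !bE => /eqP; rewrite -subr_eq0 -mulrBl.
by rewrite mulf_eq0 subr_eq0 => /orP[/eqP|/eqP //]; have := hh' k l.
Qed.

Definition desc_sum (x : V) := exists x0 x1 x2, [/\ desc (hw 0) x0,
  desc (hw (1 / 2)) x1, desc (hw (1 / 16)) x2 & x = x0 + x1 + x2].

Lemma desc_sum_subspace : subspace desc_sum.
Proof.
split; first by exists 0, 0, 0; rewrite !addr0; split => //; exact: desc0.
move=> c _ _ [x0 [x1 [x2 [d0 d1 d2 ->]]]] [y0 [y1 [y2 [e0 e1 e2 ->]]]].
exists (c *: x0 + y0), (c *: x1 + y1), (c *: x2 + y2).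
split; [exact: desc_lin..|]; apply: (form_ext br bC bpos) => z; rewrite !bE; ring.
Qed.

Lemma desc_sum_mode k x : desc_sum x -> desc_sum (nprod k a x).
Proof.
move=> [x0 [x1 [x2 [d0 d1 d2 ->]]]]; rewrite !nprodE.
exists (nprod k a x0), (nprod k a x1), (nprod k a x2).
by split => //; exact: desc_hw_mode.
Qed.

(** Complete reducibility from positivity: the part of x orthogonal to the descendants in V_m is
    singular, so [singular_decomp] applies to it. *)
Lemma grade_desc_sum (m : nat) x : grade V m x -> desc_sum x.
Proof.
elim/ltn_ind: m x => m IH x xm.
have [d [B [_ BE]]] := grade_findim V m.
pose S := [set y | grade V m y /\ desc_sum y].
have subS : subspace S.
  have [D0 DD] := desc_sum_subspace.
  split=> [|c u v [um du] [vm dv]]; first by split => //; exact: grade0.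
  by split; [exact: gradeD|exact: DD].
have [|s [sm ds] sE] := @orthogonal_projection R V b br bC bpos d
    (fun i => if insub i is Some j then B j else 0) S subS _ x.
  move=> y [/BE [c ->] _]; exists (fun i => if insub i is Some j then c j else 0).
  by apply: eq_bigr => i _; rewrite valK.
have xs : grade V m (x - s) by exact: gradeB.
(* By induction L^a(k) (x - s), k > 0, lies in desc_sum; it is orthogonal to
   itself since L^a(- k) preserves S. *)
have sing : singular (x - s).
  move=> k k2; apply: (form_eq0 bpos); have [km|km] := lerP (k - 1) m%:Z; last first.
    by rewrite (nprod_grade_lt0 a2 xs) ?bE //; lia.
  have yk : grade V (m - `|k - 1|)%N (nprod k a (x - s)).
    by apply: (nprod_grade a2 xs); lia.
  rewrite adj; apply: sE; split; first by apply: (nprod_grade a2 yk); lia.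
  by apply: desc_sum_mode; apply: IH yk; lia.
have [v0 [v1 [v2 [E h0 h1 h2 _]]]] := singular_decomp sing.
rewrite -[x](subrK s); have [_ DD] := desc_sum_subspace.
rewrite -[x - s]scale1r; apply: DD ds; exists v0, v1, v2.
by split => //; apply: (@desc_word _ 0); apply: word0.
Qed.

Lemma desc_sum_full x : desc_sum x.
Proof.
have [N [s [sg ->]]] := grade_sum x; have [D0 DD] := desc_sum_subspace.
elim/big_rec: _ => // i y _ dy.
by rewrite -[s i]scale1r; apply: DD dy; exact: grade_desc_sum (sg i).
Qed.

(** The associator formula expresses modes of products by products of modes, so the generator a is
    enough. *)
Lemma mode_stable_submodule (S : set V) : subspace S ->
  (forall k x, S x -> S (nprod k a x)) -> vir_submodule a S.
Proof.
move=> subS Sa; split=> // n u x; have [S0 SD] := subS.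
move=> au; move: u au n x; pose W := [set u | forall n x, S x -> S (nprod n u x)].
apply: (@smallest_sub _ _ _ W) => [|_ -> n x]; last exact: Sa.
split; first split=> [n x _|c u v Wu Wv n x Sx].
- by rewrite nprod0l.
- by rewrite !nprodE; apply: SD; [exact: Wu|exact: Wv].
- by move=> n x Sx; rewrite vac_nprod; case: ifP.
move=> n u v Wu Wv m x Sx.
have [N1 N1x] := nprod_trunc_nat 0 u x; have [N2 N2x] := nprod_trunc_nat m v x.
rewrite (@associator R V (N1 + N2) m n u v x); first last.
- by move=> i iN; apply: N2x; lia.
- by move=> i iN; have := N1x i; rewrite add0r; apply; lia.
apply: subspace_sum => // i; apply: subspace_Z => //; apply: subspace_B => //.
  by apply: Wu; apply: Wv.
by apply: subspace_Z => //; apply: Wv; apply: Wu.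
Qed.

Lemma is_L_desc h W : is_L a h W -> W `<=` desc (hw h).
Proof.
move=> [[[subW Wa] _ irrW] [v [Wv v0 v1 vs]]].
have va : vir a a by move=> ? [_]; apply.
have dv : hw h v by split=> // k k2; rewrite -[k](subrK 1); apply: vs; lia.
have := irrW (W `&` desc (hw h)); case.
- apply: mode_stable_submodule => [|k x [Wx dx]].
    have [W0 WD] := subW; split=> [|c x y [Wx dx] [Wy dy]]; first by split=> //; exact: desc0.
    by split; [exact: WD|exact: desc_lin].
  by split; [exact: Wa|exact: desc_hw_mode].
- by move=> x [].
- move=> W0; have : (W `&` desc (hw h)) v by split => //; apply/desc_word/word0.
  by rewrite W0 => /eqP; rewrite (negPf v0).
- by move=> <- x [].
Qed.

(** Adjoints of modes are modes, so a submodule orthogonal to x is orthogonal to all descendants of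
    x, hence to itself. Any other submodule is shown to contain x. *)
Lemma desc_is_L h x : hw h x -> x != 0 -> is_L a h (desc (eq x)).
Proof.
move=> hx x0; have Px : forall v, x = v -> hw h v by move=> v <-.
have va : vir a a by move=> ? [_]; apply.
have dx : desc (eq x) x by apply/desc_word/word0.
split; last first.
  exists x; split=> //; first by case: hx.
  by move=> n n0; case: hx => hx _; apply: hx; lia.
split; first exact: mode_stable_submodule (desc_subspace _) (desc_mode Px).
  by apply/eqP => W0; move: dx; rewrite W0 => /eqP; rewrite (negPf x0).
move=> W' [subW' W'a] W'd.
have [orth|/existsNP[y /not_implyP[W'y /eqP bxy]]] := pselect (forall y, W' y -> b x y = 0).
  left; have dorth z : desc (eq x) z -> forall y, W' y -> b z y = 0.
    elim=> [|c k u v wu _ IH] y W'y; first by rewrite bE.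
    rewrite !bE IH // addr0; suff -> : b u y = 0 by rewrite mulr0.
    elim: wu y W'y => [_ <-|j n w _ IHw] y W'y; first exact: orth.
    by rewrite adj IHw //; apply: W'a.
  apply/seteqP; split=> [y W'y|_ ->]; last by case: subW'.
  by apply: (form_eq0 bpos); apply: dorth => //; apply: W'd.
right; apply/seteqP; split => //.
suff W'x : W' x.
  have W'w (k : nat) u : word (eq x) k u -> W' u by elim=> [_ <- //|j n w _]; exact: W'a.
  move=> z; elim=> [|c k u v wu _ W'v]; first by case: subW'.
  by case: subW' => _; apply => //; exact: W'w wu.
(* Apply the product of the L^a(0) - h - i, 0 < i <= M, to y: for large M this
   annihilates all components of y but the one along x. *)
pose pr := fix pr M z : V :=
  if M is M'.+1 then nprod 1 a (pr M' z) - (h + M%:R) *: pr M' z else z.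
have W'pr M z : W' z -> W' (pr M z).
  by move=> W'z; elim: M => //= M IH; apply: subspace_B; [|exact: W'a|exact: subspace_Z].
have prD M c u v : pr M (c *: u + v) = c *: pr M u + pr M v.
  elim: M => //= M ->; rewrite !nprodE.
  by apply: (form_ext br bC bpos) => z; rewrite !bE; ring.
have prw M (k : nat) u : nprod 1 a u = (h + k%:R) *: u ->
    pr M u = (\prod_(i < M) (k%:R - i.+1%:R)) *: u.
  move=> uk; elim: M => [|M IH]; first by rewrite big_ord0 scale1r.
  rewrite /= IH nprodZr uk big_ord_recr /= !scalerA -scalerBl; congr (_ *: _); ring.
pose q M : R := \prod_(i < M) (0%:R - i.+1%:R).
have q0 M : q M != 0.
  by apply/prodf_neq0 => i _; rewrite sub0r oppr_eq0 pnatr_eq0.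
have x1 : nprod 1 a x = (h + 0%:R) *: x by rewrite addr0; case: hx.
have prE z : desc (eq x) z -> exists (r : R) N, b x z = r * b x x /\
    forall M, (N <= M)%N -> pr M z = (r * q M) *: x.
  elim=> [|c k u v wu _ [r [N [bv prv]]]].
    exists 0, 0%N; split=> [|M _]; first by rewrite bE mul0r.
    have z1 : nprod 1 a 0 = (h + 0%:R) *: (0 : V) by rewrite nprod0r scaler0.
    by rewrite (prw M 0%N 0 z1) scaler0 mul0r scale0r.
  have u1 := word_weight Px wu; have [k0|k0] := posnP k.
    have xu : x = u by case: {u1} wu k0 => // j n w _; rewrite addnS.
    exists (c + r), N; split=> [|M NM]; first by rewrite !bE bv -xu; ring.
    by rewrite prD prv // -xu (prw M 0%N x x1) scalerA -scalerDl mulrDl.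
  exists r, (maxn N k); split=> [|M].
    rewrite !bE bv; suff -> : b x u = 0 by rewrite mulr0 add0r.
    have := adj 1 x u; rewrite (_ : 2 - 1 = 1) // u1 x1 addr0 !bE => /eqP.
    rewrite mulrDl -subr_eq0 opprD addrA subrr add0r oppr_eq0 mulf_eq0.
    by rewrite pnatr_eq0 -leqn0 leqNgt k0 => /eqP.
  rewrite geq_max => /andP[NM kM]; rewrite prD prv // (prw _ _ _ u1).
  have kM' : (k.-1 < M)%N by rewrite prednK.
  by rewrite (bigD1 (Ordinal kM')) //= prednK // subrr mul0r scale0r scaler0 add0r.
have [r [N [bxyr prN]]] := prE y (W'd _ W'y).
have rq0 : r * q N != 0.
  by rewrite mulf_neq0 ?q0 //; apply: contra_neq bxy => r0; rewrite bxyr r0 mul0r.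
rewrite -[x]scale1r -(mulVf rq0) -scalerA; apply: subspace_Z => //.
by rewrite -prN //; exact: W'pr.
Qed.

Lemma isotypic_desc h : isotypic a h = desc (hw h).
Proof.
apply/seteqP; split=> [|x dx].
  apply: smallest_sub; first exact: desc_subspace.
  by move=> x [W /is_L_desc]; apply.
move=> S [[S0 SD] SL]; elim: dx => [//|c k u v wu _ Sv]; apply: SD => {v Sv} //.
suff [y hy wy] : exists2 y, hw h y & word (eq y) k u.
  have [y0|y0] := eqVneq y 0.
    suff -> : u = 0 by [].
    rewrite y0 in wy; elim: wy => [_ <- //|j n w _ ->]; exact: nprod0r.
  by apply: SL; exists (desc (eq y)); [exact: desc_is_L|exact: desc_word wy].
elim: wu => [y hy|j n w _ [y hy wy]]; first by exists y => //; exact: word0.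
by exists y => //; exact: wordS.
Qed.

Local Notation Vzero := (desc (hw 0)).
Local Notation Vhalf := (desc (hw (1 / 2))).
Local Notation Vodd := (desc (hw (1 / 16))).

Let weights_neq (k l : nat) : [/\ (0 + k%:R : R) <> 1 / 16 + l%:R,
  (1 / 2 + k%:R : R) <> 1 / 16 + l%:R & (0 + k%:R : R) <> 1 / 2 + l%:R].
Proof.
split=> E.
- have /eqP : ((16 * k)%N%:R = (16 * l + 1)%N%:R :> R) by rewrite ?natrD ?natrM; lra.
  by rewrite eqr_nat => /eqP; lia.
- have /eqP : ((16 * k + 8)%N%:R = (16 * l + 1)%N%:R :> R) by rewrite ?natrD ?natrM; lra.
  by rewrite eqr_nat => /eqP; lia.
- have /eqP : ((2 * k)%N%:R = (2 * l + 1)%N%:R :> R) by rewrite ?natrD ?natrM; lra.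
  by rewrite eqr_nat => /eqP; lia.
Qed.

Let orth02 x y : Vzero x -> Vodd y -> b x y = 0.
Proof. by apply: desc_orthogonal => k l; case: (weights_neq k l). Qed.

Let orth12 x y : Vhalf x -> Vodd y -> b x y = 0.
Proof. by apply: desc_orthogonal => k l; case: (weights_neq k l). Qed.

Let orth01 x y : Vzero x -> Vhalf y -> b x y = 0.
Proof. by apply: desc_orthogonal => k l; case: (weights_neq k l). Qed.

Definition even_part (x : V) := exists x0 x1, [/\ Vzero x0, Vhalf x1 & x = x0 + x1].

Lemma even_subspace : subspace even_part.
Proof.
split; first by exists 0, 0; rewrite addr0; split => //; exact: desc0.
move=> c _ _ [x0 [x1 [d0 d1 ->]]] [y0 [y1 [e0 e1 ->]]].
exists (c *: x0 + y0), (c *: x1 + y1); split; [exact: desc_lin..|].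
by rewrite scalerDr addrACA.
Qed.

Lemma even_odd_decomp x : exists p m : V, [/\ even_part p, Vodd m & x = p + m].
Proof.
have [x0 [x1 [x2 [d0 d1 d2 ->]]]] := desc_sum_full x.
by exists (x0 + x1), x2; split=> //; exists x0, x1.
Qed.

Lemma even_odd_eq (p m p' m' : V) : even_part p -> Vodd m -> even_part p' -> Vodd m' ->
  p + m = p' + m' -> p = p' /\ m = m'.
Proof.
move=> ep dm ep' dm' E.
have [S0 SD] := even_subspace; have [x0 [x1 [d0 d1 xE]]] : even_part (p - p').
  by rewrite -scaleN1r addrC; apply: SD.
have dd : Vodd (m' - m) by rewrite -scaleN1r addrC; apply: desc_lin.
have pm : p - p' = m' - m.
  by apply/eqP; rewrite subr_eq addrAC -subr_eq opprK E addrC.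
have mm : m' - m = 0.
  by apply: (form_eq0 bpos); rewrite -{1}pm xE (form_Dl br bC) (orth02 d0 dd) (orth12 d1 dd) addr0.
by split; apply/eqP; rewrite -subr_eq0 ?pm ?mm // -opprB mm oppr0.
Qed.

Lemma nprod_even h1 h2 n u v : forbidden h1 h2 (1 / 16) ->
  desc (hw h1) u -> desc (hw h2) v -> even_part (nprod n u v).
Proof.
move=> fb du dv; have [p [m [ep dm E]]] := even_odd_decomp (nprod n u v).
suff m0 : m = 0 by rewrite E m0 addr0.
have [x0 [x1 [d0 d1 xE]]] := ep; apply: (form_eq0 bpos).
have := desc_fusion n fb du dv dm; rewrite E xE !bE.
by rewrite (bC m x0) (bC m x1) (orth02 d0 dm) (orth12 d1 dm) !add0r.
Qed.

Lemma nprod_odd h1 h2 n u v : forbidden h1 h2 0 -> forbidden h1 h2 (1 / 2) ->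
  desc (hw h1) u -> desc (hw h2) v -> Vodd (nprod n u v).
Proof.
move=> fb0 fb1 du dv; have [_ [m [[x0 [x1 [d0 d1 ->]]] dm E]]] := even_odd_decomp (nprod n u v).
have x00 : x0 = 0.
  apply: (form_eq0 bpos); have := desc_fusion n fb0 du dv d0; rewrite E !bE.
  by rewrite (orth02 d0 dm) (orth01 d0 d1) !addr0.
have x10 : x1 = 0.
  apply: (form_eq0 bpos); have := desc_fusion n fb1 du dv d1; rewrite E !bE.
  by rewrite (orth12 d1 dm) (bC x1 x0) (orth01 d0 d1) addr0 add0r.
by rewrite E x00 x10 !add0r.
Qed.

Let fb_even : [/\ forbidden 0 0 (1 / 16 : R), forbidden 0 (1 / 2 : R) (1 / 16),
  forbidden (1 / 2) 0 (1 / 16 : R), forbidden (1 / 2 : R) (1 / 2) (1 / 16) &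
  forbidden (1 / 16 : R) (1 / 16) (1 / 16)].
Proof.
by split; rewrite /forbidden /=;
  first [by left; split=> [|?]; lra|by right; split=> [|?]; lra].
Qed.

Let fb_odd : [/\ forbidden 0 (1 / 16 : R) 0, forbidden 0 (1 / 16) (1 / 2 : R),
  forbidden (1 / 2 : R) (1 / 16) 0 & forbidden (1 / 2 : R) (1 / 16) (1 / 2)].
Proof.
by split; rewrite /forbidden /=;
  first [by left; split=> [|?]; lra|by right; split=> [|?]; lra].
Qed.

Let fb_odd' : [/\ forbidden (1 / 16 : R) 0 0, forbidden (1 / 16) 0 (1 / 2 : R),
  forbidden (1 / 16 : R) (1 / 2) 0 & forbidden (1 / 16 : R) (1 / 2) (1 / 2)].
Proof.
by split; rewrite /forbidden /=;
  first [by left; split=> [|?]; lra|by right; split=> [|?]; lra].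
Qed.

Lemma hw_vac : hw 0 (vac V).
Proof. by split=> [k k2|]; rewrite nprod_vac_ge0 ?scale0r //; lia. Qed.

Lemma desc_self : Vzero a.
Proof.
suff : Vzero (nprod (- 1%N%:Z) a (vac V)) by rewrite nprod_vacN1.
apply: desc_word; apply: (@wordS _ 0 1); apply: word0; exact: hw_vac.
Qed.

(* A vector of V_2 is orthogonal to a iff it is singular, as V_1 = 0. *)
Lemma singular_orthogonal x : grade V 2 x -> b a x = 0 -> singular x.
Proof.
move=> x2 ax k k2; have [k4|k4] := lerP 4 k; first exact: (weight2_mode_ge4 a2).
have [k3|k3] := lerP 3 k.
  by rewrite (_ : k = 3) ?(weight2_mode3 hV hb) // ?ax ?scale0r //; lia.
by rewrite (_ : k = 2) ?(weight2_mode2 hV) //; lia.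
Qed.

(** The difference of the conformal vector and a is a highest weight vector of weight 0. This makes
    the involution fix the conformal vector. *)
Lemma desc_conf : Vzero (conf V).
Proof.
have c2 := grade_conf V; have aa : nprod 1 a a = 2 *: a by case: ha.
have ac : nprod 1 a (conf V) = 2 *: a by rewrite (griess_mulC hV hb) // (grade_L0 a2).
have bac : b a (conf V - a) = 0.
  have := adj 1 a (conf V - a); rewrite (_ : 2 - 1 = 1) // nprodBr ac aa subrr.
  by rewrite (form_Zl br bC) (form_0r br) => /eqP; rewrite mulf_eq0 pnatr_eq0 => /eqP.
rewrite -[conf V](subrK a) -[conf V - a]scale1r; apply: desc_lin desc_self.
apply/desc_word/word0; split; last by rewrite nprodBr ac aa subrr scale0r.
by apply: singular_orthogonal bac; exact: gradeB.
Qed.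

(** Since [tau] is chosen by [xget], an involution has to be exhibited; it is multiplicative by
    [nprod_even] and [nprod_odd]. *)
Lemma is_tau_exists : exists t, is_tau a t.
Proof.
have [S0 SD] := even_subspace.
pose pm x := xget (0, 0) [set c : V * V | [/\ even_part c.1, Vodd c.2 & x = c.1 + c.2]].
have pmP x : [/\ even_part (pm x).1, Vodd (pm x).2 & x = (pm x).1 + (pm x).2].
  by rewrite /pm; case: xgetP => [c -> //|]; have [p [m H]] := even_odd_decomp x => /(_ (p, m)).
pose t x := (pm x).1 - (pm x).2.
have tE (p m : V) : even_part p -> Vodd m -> t (p + m) = p - m.
  move=> ep dm; have [ep' dm' E] := pmP (p + m).
  by rewrite /t; have [<- <-] := even_odd_eq ep dm ep' dm' E.
have te (p : V) : even_part p -> t p = p.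
  by move=> ep; rewrite -[p in LHS]addr0 tE ?subr0 //; exact: desc0.
have to (m : V) : Vodd m -> t m = - m.
  by move=> dm; rewrite -[m in LHS]add0r tE ?sub0r.
have tt x : t (t x) = x.
  have [ep dm E] := pmP x; rewrite [t x]/t -scaleN1r tE //.
    by rewrite scaleN1r opprK -E.
  by rewrite -[_ *: _]addr0; apply: desc_lin (desc0 _).
have tlin : linear t.
  move=> c x y; have [ep dm xE] := pmP x; have [ep' dm' yE] := pmP y; rewrite {1}xE {1}yE.
  have -> : c *: ((pm x).1 + (pm x).2) + ((pm y).1 + (pm y).2) =
    (c *: (pm x).1 + (pm y).1) + (c *: (pm x).2 + (pm y).2) by rewrite scalerDr addrACA.
  rewrite tE; [|exact: SD|exact: desc_lin].
  by rewrite /t scalerBr opprD addrACA.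
have tD x y : t (x + y) = t x + t y by have := tlin 1 x y; rewrite !scale1r.
have e0 x : Vzero x -> even_part x.
  by move=> dx; exists x, 0; rewrite addr0; split => //; exact: desc0.
have e1 x : Vhalf x -> even_part x.
  by move=> dx; exists 0, x; rewrite add0r; split => //; exact: desc0.
have sD x y : even_part x -> even_part y -> even_part (x + y).
  by move=> ex ey; rewrite -[x]scale1r; apply: SD.
have [f1 f2 f3 f4 f5] := fb_even; have [g1 g2 g3 g4] := fb_odd.
have [k1 k2 k3 k4] := fb_odd'.
have tau : is_tau a t.
  split; last by move=> x; rewrite isotypic_desc; exact: to.
  - split => //; first by exists t.
    + move=> n x y; have [[x0 [x1 [dx0 dx1 xe]]] dx2 xE] := pmP x.
      have [[y0 [y1 [dy0 dy1 ye]]] dy2 yE] := pmP y.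
      rewrite {1}xE {1}yE [t x]/t [t y]/t xe ye !nprodE !tD.
      rewrite (te _ (nprod_even n f1 dx0 dy0)) (te _ (nprod_even n f2 dx0 dy1)).
      rewrite (te _ (nprod_even n f3 dx1 dy0)) (te _ (nprod_even n f4 dx1 dy1)).
      rewrite (te _ (nprod_even n f5 dx2 dy2)).
      rewrite (to _ (nprod_odd n g1 g2 dx0 dy2)) (to _ (nprod_odd n g3 g4 dx1 dy2)).
      rewrite (to _ (nprod_odd n k1 k2 dx2 dy0)) (to _ (nprod_odd n k3 k4 dx2 dy1)).
      by apply: (form_ext br bC bpos) => z; rewrite !bE; ring.
    + exact/te/e0/desc_word/word0/hw_vac.
    + exact/te/e0/desc_conf.
  - by move=> x; rewrite isotypic_desc => /e0/te.
  - by move=> x; rewrite isotypic_desc => /e1/te.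
by exists t.
Qed.

Lemma tauP : is_tau a (tau a).
Proof. by apply: (@xgetPex _ _ [set t | is_tau a t]); exact: is_tau_exists. Qed.

Lemma tau_hw x : [/\ hw 0 x -> tau a x = x, hw (1 / 2) x -> tau a x = x &
  hw (1 / 16) x -> tau a x = - x].
Proof.
have [_ t0 t1 t2] := tauP.
by split=> hx; [apply: t0|apply: t1|apply: t2]; rewrite isotypic_desc; apply/desc_word/word0.
Qed.

Lemma tau_self : tau a a = a.
Proof. by have [_ t0 _ _] := tauP; rewrite t0 // isotypic_desc; exact: desc_self. Qed.

Lemma tau_involutive x : tau a (tau a x) = x.
Proof.
have [[tlin _ _ _ _] t0 t1 t2] := tauP; rewrite !isotypic_desc in t0 t1 t2.
have tD y z : tau a (y + z) = tau a y + tau a z.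
  by have := tlin 1 y z; rewrite !scale1r.
have [x0 [x1 [x2 [d0 d1 d2 ->]]]] := desc_sum_full x.
rewrite !tD !(t0 _ d0) !(t1 _ d1) (t2 _ d2).
rewrite t2 ?opprK // -scaleN1r -[_ *: _]addr0.
exact: desc_lin d2 (desc0 _).
Qed.

End IsingVector.

(** * Two axes *)

Section AxialVectors.
Variables (R : realType) (M : lmodType R) (mul : M -> M -> M).

(* Fixed by the involution of a: the component of x for 1/32 is cancelled. *)
Definition sg (a x : M) : M := mul a x - 32^-1 *: (a + x).

(* For an axis a with involution t and for l = (a, x), the components of x in
   the eigenspaces of a for the eigenvalues 0 and 1/4. *)
Definition part0 (a : M) (t : M -> M) (l : R) (x : M) : M :=
  (7 / 16) *: (x + t x) - 4 *: sg a x + (3 * l - 8^-1) *: a.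
Definition part4 (a : M) (t : M -> M) (l : R) (x : M) : M :=
  4 *: sg a x + 16^-1 *: (x + t x) + (8^-1 - 4 * l) *: a.

(* The values of a Y and S S, for P = b + s b, Q = t a + s (t a), S = sg a b,
   S2 = sg a (t a), Y = sg b (s b), l = (a, b) and n = (b, s b).  Numerals are unary,
   so large denominators are written as products. *)
Definition dihedral_aY (a P Q S S2 : M) (l n : R) : M :=
  (32 / 3 * l - 19 / 48) *: S
  + (5 / 3 * l - 127 / (96 * 32) - 32 / 3 * l ^+ 2 - n / 24) *: a
  + (l / 6 - 19 / (96 * 32)) *: P + (7 / 96) *: S2 + (7 / (64 * 96)) *: Q.

Definition dihedral_SS (a P Q S S2 Y : M) (l n : R) : M :=
  (- (13 / (48 * 32)) - 5 / 12 * l) *: S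
  + (7 / 6 * l ^+ 2 + 7 / (48 * 32) * n - 7 / (64 * 64 * 24) - 7 / (12 * 32) * l) *: a
  + (49 / (24 * 32) * l - 245 / (64 * 64 * 48)) *: P - (7 / (48 * 32)) *: S2
  + (49 / (64 * 64 * 48)) *: Q + (7 / (64 * 32)) *: Y.

End AxialVectors.

Section MetricAlgebra.
Variables (R : realType) (M : lmodType R).
Variables (mul : M -> M -> M) (form : M -> M -> R).
Hypotheses (mul_lin : forall x, linear (mul x)) (mulC : forall x y, mul x y = mul y x).
Hypotheses (br : forall x, scalar (form x)) (bC : forall x y, form x y = form y x).
Hypotheses (bpos : forall x, x != 0 -> 0 < form x x).
Hypothesis formA : forall x y z, form (mul x y) z = form x (mul y z).
Let bE := formE br bC.

Lemma mul_Dr x y z : mul x (y + z) = mul x y + mul x z.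
Proof. by have := mul_lin x 1 y z; rewrite !scale1r. Qed.

Lemma mul_0r x : mul x 0 = 0.
Proof. by apply: (@addrI _ (mul x 0)); rewrite -mul_Dr !addr0. Qed.

Lemma mul_Zr x c y : mul x (c *: y) = c *: mul x y.
Proof. by have := mul_lin x c y 0; rewrite !addr0 mul_0r addr0. Qed.

Lemma mul_Nr x y : mul x (- y) = - mul x y.
Proof. by rewrite -scaleN1r mul_Zr scaleN1r. Qed.

Lemma mul_Dl x y z : mul (x + y) z = mul x z + mul y z.
Proof. by rewrite mulC mul_Dr !(mulC z). Qed.

Lemma mul_0l x : mul 0 x = 0.
Proof. by rewrite mulC mul_0r. Qed.

Lemma mul_Zl c x y : mul (c *: x) y = c *: mul x y.
Proof. by rewrite mulC mul_Zr mulC. Qed.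

Lemma mul_Nl x y : mul (- x) y = - mul x y.
Proof. by rewrite mulC mul_Nr mulC. Qed.

Definition algE := (mul_Dr, mul_Dl, mul_Nr, mul_Nl, mul_Zr, mul_Zl, mul_0r, mul_0l).

(** The eigenvalues are h / 2 for h = 0, 1/2, 1/16. In [axis_44] the product has components only
    along a and in the 0-eigenspace, and (a, x y) = (a x, y) = (x, y) / 4. *)
Record axis (a : M) (t : M -> M) : Prop := Axis {
  axis_idem : mul a a = a;
  axis_norm : form a a = 1;
  axis_dec : forall x, exists u v w, [/\ x = form a x *: a + u + v + w,
    mul a u = 0, mul a v = 4^-1 *: v & mul a w = 32^-1 *: w];
  axis_00 : forall x y, mul a x = 0 -> mul a y = 0 -> mul a (mul x y) = 0;
  axis_04 : forall x y, mul a x = 0 -> mul a y = 4^-1 *: y ->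
    mul a (mul x y) = 4^-1 *: mul x y;
  axis_44 : forall x y, mul a x = 4^-1 *: x -> mul a y = 4^-1 *: y ->
    mul a (mul x y) = (form x y / 4) *: a;
  axis_lin : linear t;
  axis_mul : forall x y, t (mul x y) = mul (t x) (t y);
  axis_form : forall x y, form (t x) (t y) = form x y;
  axis_inv : forall x, t (t x) = x;
  axis_fix : t a = a;
  axis_fix0 : forall x, mul a x = 0 -> t x = x;
  axis_fix4 : forall x, mul a x = 4^-1 *: x -> t x = x;
  axis_neg : forall x, mul a x = 32^-1 *: x -> t x = - x
}.

Section OneAxis.
Variables (a : M) (t : M -> M).
Hypothesis at_axis : axis a t.

Lemma axis_D x y : t (x + y) = t x + t y.
Proof. by have := axis_lin at_axis 1 x y; rewrite !scale1r. Qed.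

Lemma axis_Z c x : t (c *: x) = c *: t x.
Proof.
have t0 : t 0 = 0 by apply: (@addrI _ (t 0)); rewrite -axis_D !addr0.
by have := axis_lin at_axis c x 0; rewrite !addr0 t0 addr0.
Qed.

Lemma axis_N x : t (- x) = - t x.
Proof. by rewrite -scaleN1r axis_Z scaleN1r. Qed.

Lemma axis_parts x : [/\ mul a (part0 mul a t (form a x) x) = 0,
  mul a (part4 mul a t (form a x) x) = 4^-1 *: part4 mul a t (form a x) x &
  t (sg mul a x) = sg mul a x].
Proof.
have [u [v [w [xE u0 v0 w0]]]] := axis_dec at_axis x.
move: (form a x) xE => l {x}->.
set x := _ + w; have tx : t x = l *: a + u + v - w.
  rewrite !axis_D axis_Z (axis_fix at_axis).
  by rewrite (axis_fix0 at_axis u0) (axis_fix4 at_axis v0) (axis_neg at_axis w0).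
have sE : sg mul a x = l *: a + 4^-1 *: v + 32^-1 *: w - 32^-1 *: (a + x).
  by rewrite /sg {1}/x !algE (axis_idem at_axis) u0 v0 w0 addr0.
have p0 : part0 mul a t l x = u.
  by rewrite /part0 sE tx /x; apply: (form_ext br bC bpos) => z; rewrite !bE; field.
have p4 : part4 mul a t l x = v.
  by rewrite /part4 sE tx /x; apply: (form_ext br bC bpos) => z; rewrite !bE; field.
split; rewrite ?p0 ?p4 // sE !(axis_D, axis_N, axis_Z) (axis_fix at_axis).
rewrite (axis_fix0 at_axis u0) (axis_fix4 at_axis v0) (axis_neg at_axis w0).
by apply: (form_ext br bC bpos) => z; rewrite /x !bE; field.
Qed.

(** The equation a [part0] = 0, solved for the product. As t x has a nonzero coefficient, it also
    recovers t x from products. *)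
Lemma axis_mul_sg x : mul a (sg mul a x) = (7 / 32) *: sg mul a x
  + (7 / (64 * 32)) *: (x + t x) + (3 / 4 * form a x - 25 / (32 * 32)) *: a.
Proof.
have [p0 _ ts] := axis_parts x; rewrite /part0 in p0.
have tx : mul a (t x) = sg mul a x + 32^-1 *: (a + t x).
  by rewrite -ts /sg !(axis_D, axis_N, axis_Z) (axis_mul at_axis) (axis_fix at_axis) subrK.
have ax : mul a x = sg mul a x + 32^-1 *: (a + x) by rewrite /sg subrK.
move: (sg mul a x) (form a x) tx ax p0 => s l tx ax.
rewrite !algE tx ax (axis_idem at_axis) => E.
apply: (form_ext br bC bpos) => z; have := congr1 (form^~ z) E; rewrite /= !bE; lra.
Qed.

Lemma axis_form_sg x : form a (sg mul a x) = (31 * form a x - 1) / 32.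
Proof.
by rewrite /sg !bE -formA (axis_idem at_axis) (axis_norm at_axis); field.
Qed.

End OneAxis.

(* A and B are the eigenvectors part0 and part4 of the axis a for the vector b,
   written with P = b + t b; the three fusion rules are linear equations in
   S S, a (S S) and a Y. *)
Lemma dihedral_products a P S Q S2 Y (l n : R) :
  let A := (7 / 16) *: P - 4 *: S + (3 * l - 8^-1) *: a in
  let B := 4 *: S + 16^-1 *: P + (8^-1 - 4 * l) *: a in
  let k := 3 / 4 * l - 25 / (32 * 32) in
  mul a a = a -> mul a P = 2 *: S + 32^-1 *: (2 *: a + P) ->
  mul a S = (7 / 32) *: S + (7 / (64 * 32)) *: P + k *: a ->
  mul a Q = 2 *: S2 + 32^-1 *: (2 *: a + Q) ->
  mul P P = (17 / 16) *: P + 2 *: Y ->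
  mul P S = (7 / 16) *: S + (7 / (64 * 32)) *: (2 *: a + Q) + k *: P ->
  mul a (mul A A) = 0 -> mul a (mul A B) = 4^-1 *: mul A B ->
  mul a (mul B B) = (l - 64^-1 - l ^+ 2 + n / 64) *: a ->
  mul a Y = dihedral_aY a P Q S S2 l n /\
  mul S S = dihedral_SS a P Q S S2 Y l n.
Proof.
move=> A B k aa aP aS aQ PP PS EA EAB EB.
have Pa : mul P a = mul a P by []. have Sa : mul S a = mul a S by [].
have SP : mul S P = mul P S by [].
rewrite /A /B !algE in EA EAB EB.
rewrite ?Pa ?Sa ?SP ?aa ?aP ?aS ?PP ?PS in EA EAB EB.
do 3 rewrite ?algE ?aP ?aS ?aa ?aQ in EA EAB EB.
split; apply: (form_ext br bC bpos) => z.
  move: (congr1 (form^~ z) EA) (congr1 (form^~ z) EB); rewrite /= /dihedral_aY !bE /k; lra.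
move: (congr1 (form^~ z) EA) (congr1 (form^~ z) EB) (congr1 (form^~ z) EAB).
rewrite /= /dihedral_SS !bE /k; lra.
Qed.

End MetricAlgebra.

(* The coefficient of a in the decomposition of Y = sg b (s b) for the axis a. *)
Definition dihedral_r (R : realType) (l m : R) : R :=
  5 / 3 * l - 127 / (96 * 32) - 32 / 3 * l ^+ 2 - m / 24
  - (32 / 3 * l - 19 / 48) / 4 * (8^-1 - 4 * l) - 7 / (12 * 32) * (8^-1 - 4 * m).

(* The relations, for the axis a, between the vectors of the dihedral algebra of
   the axes a and b with involutions s and t, where l = (a, b) and
   m = (a, t a) = (b, s b). *)
Record dihedral (R : realType) (M : lmodType R) (mul : M -> M -> M) (a b : M)
    (s t : M -> M) (l m : R) : Prop := Dihedral {
  dih_idem : mul a a = a;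
  dih_lin : linear s;
  dih_mul : forall x y, s (mul x y) = mul (s x) (s y);
  dih_inv : forall x, s (s x) = x;
  dih_fix : s a = a;
  dih_fixb : s (sg mul a b) = sg mul a b;
  dih_fixt : s (sg mul a (t a)) = sg mul a (t a);
  dih_00 : forall x y, mul a x = 0 -> mul a y = 0 -> mul a (mul x y) = 0;
  dih_04 : forall x y, mul a x = 0 -> mul a y = 4^-1 *: y ->
    mul a (mul x y) = 4^-1 *: mul x y;
  dih_b0 : mul a (part0 mul a s l b) = 0;
  dih_b4 : mul a (part4 mul a s l b) = 4^-1 *: part4 mul a s l b;
  dih_t0 : mul a (part0 mul a s m (t a)) = 0;
  dih_t4 : mul a (part4 mul a s m (t a)) = 4^-1 *: part4 mul a s m (t a);
  dih_Y0 : mul a (sg mul b (s b) - ((32 / 3 * l - 19 / 48) *: part4 mul a s l b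
    + (7 / 96) *: part4 mul a s m (t a) + dihedral_r l m *: a)) = 0;
  dih_SS : mul (sg mul a b) (sg mul a b) = dihedral_SS a (b + s b)
    (t a + s (t a)) (sg mul a b) (sg mul a (t a)) (sg mul b (s b)) l m;
  dih_rel : s (t a) = s b + t (s b) - t a
    + (8 * 32 * l - 5) *: (a + t a - b - s b)
    + ((32 * (32 * 32) * l ^+ 2 + 128 * m - 16 * 32 * l - 2) / 7) *: (b - a)
    + 32 *: (sg mul a (t a) - sg mul b (s b))
}.

(** * Linear relations between two axes and their images *)

Section TwoAxes.
Variables (R : realType) (M : lmodType R).
Variables (mul : M -> M -> M) (form : M -> M -> R).
Hypotheses (mul_lin : forall x, linear (mul x)) (mulC : forall x y, mul x y = mul y x).
Hypotheses (br : forall x, scalar (form x)) (bC : forall x y, form x y = form y x).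
Hypotheses (bpos : forall x, x != 0 -> 0 < form x x).
Hypothesis formA : forall x y z, form (mul x y) z = form x (mul y z).
Let bE := formE br bC.
Let mulE := algE mul_lin mulC.
Local Notation axis := (axis mul form).

(** As x is idempotent, (a, x) = (a x, x), a sum of squared norms weighted by the eigenvalues 1, 0,
    1/4, 1/32. *)
Lemma axis_form_ge0 a t x : axis a t -> mul x x = x -> 0 <= form a x.
Proof.
move=> ha xx; have [u [v [w [xE u0 v0 w0]]]] := axis_dec ha x.
have orth y z c d : c != d -> mul a y = c *: y -> mul a z = d *: z -> form y z = 0.
  move=> cd yc zd; have := formA y a z; rewrite mulC yc zd !bE => /eqP.
  by rewrite -subr_eq0 -mulrBl mulf_eq0 subr_eq0 (negPf cd) => /eqP.
have a1 : mul a a = 1 *: a by rewrite scale1r (axis_idem ha).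
have u0' : mul a u = 0 *: u by rewrite scale0r.
have ne (c d : R) : c - d != 0 -> c != d by rewrite subr_eq0.
have au : form a u = 0 by apply: orth a1 u0'; rewrite oner_eq0.
have av : form a v = 0 by apply: orth a1 v0; apply/eqP; lra.
have aw : form a w = 0 by apply: orth a1 w0; apply/eqP; lra.
have uv : form u v = 0 by apply: orth u0' v0; apply/eqP; lra.
have uw : form u w = 0 by apply: orth u0' w0; apply/eqP; lra.
have vw : form v w = 0 by apply: orth v0 w0; apply/eqP; lra.
have ge0 y : 0 <= form y y.
  by have [->|/bpos/ltW //] := eqVneq y 0; rewrite bE.
have -> : form a x = form (mul a x) x by rewrite formA xx.
have := ge0 v; have := ge0 w; have := sqr_ge0 (form a x).
move: (form a x) xE => l -> l2 v2 w2; rewrite !mulE (axis_idem ha) u0 v0 w0.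
rewrite !bE (axis_norm ha) (bC v a) (bC v u) (bC w a) (bC w u) (bC w v).
by rewrite au av aw uv uw vw; lra.
Qed.

Section Half.
Variables (a b : M) (s t : M -> M).
Hypotheses (ha : axis a s) (hb : axis b t).
Variables (l n : R) (S S2 Y : M).
Hypotheses (lE : form a b = l) (nE : form b (s b) = n).
Hypotheses (SE : sg mul a b = S) (S2E : sg mul a (t a) = S2) (YE : sg mul b (s b) = Y).

Let sD := axis_D ha.
Let sZ := axis_Z ha.

Lemma dih_sS : s S = S.
Proof. by have [_ _] := axis_parts mul_lin br bC bpos ha b; rewrite SE. Qed.

Lemma dih_SC : sg mul b a = S.
Proof. by rewrite -SE /sg mulC (addrC a). Qed.

Let mul_sg x : mul a x = sg mul a x + 32^-1 *: (a + x).
Proof. by rewrite /sg subrK. Qed.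

Lemma form_a_sb : form a (s b) = l.
Proof. by rewrite -[in LHS](axis_fix ha) (axis_form ha). Qed.

Lemma form_a_S : form a S = (31 * l - 1) / 32.
Proof. by rewrite -SE (axis_form_sg br formA ha) lE. Qed.

Lemma form_b_S : form b S = (31 * l - 1) / 32.
Proof. by rewrite -dih_SC (axis_form_sg br formA hb) bC lE. Qed.

Lemma form_sb_S : form (s b) S = (31 * l - 1) / 32.
Proof. by rewrite -dih_sS (axis_form ha) form_b_S. Qed.

Lemma form_a_Y : form a Y = (31 * l - 1) / 32 + (n - l) / 32.
Proof.
have -> : form a Y = form (mul a b) (s b) - 32^-1 * (form a b + form a (s b)).
  by rewrite formA -YE /sg !bE.
by rewrite mul_sg SE !bE form_a_sb lE nE (bC S) form_sb_S; field.
Qed.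

Let aS : mul a S = (7 / 32) *: S + (7 / (64 * 32)) *: (b + s b)
  + (3 / 4 * l - 25 / (32 * 32)) *: a.
Proof. by rewrite -SE (axis_mul_sg mul_lin br bC bpos ha) lE. Qed.

Lemma form_SS : form S S = (7 / 32) * ((31 * l - 1) / 32)
  + (7 / (64 * 32)) * (1 + n) + (3 / 4 * l - 25 / (32 * 32)) * l - (31 * l - 1) / (16 * 32).
Proof.
have -> : form S S = form b (mul a S) - 32^-1 * (form a S + form b S).
  by rewrite -{1}SE /sg !bE mulC formA.
rewrite aS !bE form_a_S form_b_S (axis_norm hb) nE (bC b a) lE.
by field.
Qed.

Lemma dihedral_half :
  mul a Y = dihedral_aY a (b + s b) (t a + s (t a)) S S2 l n /\
  mul S S = dihedral_SS a (b + s b) (t a + s (t a)) S S2 Y l n.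
Proof.
set P := b + s b; set Q := t a + s (t a).
have [pa pb _] := axis_parts mul_lin br bC bpos ha b; rewrite lE in pa pb.
have sx x : mul a (s x) = sg mul a x + 32^-1 *: (a + s x).
  have [_ _ {1}<-] := axis_parts mul_lin br bC bpos ha x.
  by rewrite /sg sD (axis_N ha) sZ (axis_mul ha) (axis_fix ha) sD (axis_fix ha) subrK.
have sbsb : mul (s b) (s b) = s b by rewrite -(axis_mul ha) (axis_idem hb).
have bsb : mul b (s b) = Y + 32^-1 *: (b + s b) by rewrite -YE /sg subrK.
have bS : mul b S = (7 / 32) *: S + (7 / (64 * 32)) *: (a + t a)
    + (3 / 4 * l - 25 / (32 * 32)) *: b.
  by rewrite -dih_SC (axis_mul_sg mul_lin br bC bpos hb) (bC b a) lE.
(* The image of [bS] under s, which fixes S. *)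
have sbS : mul (s b) S = (7 / 32) *: S + (7 / (64 * 32)) *: (a + s (t a))
    + (3 / 4 * l - 25 / (32 * 32)) *: s b.
  by rewrite -{1}dih_sS -(axis_mul ha) bS !(sD, sZ) dih_sS (axis_fix ha).
apply: (dihedral_products mul_lin mulC br bC bpos) => //.
- exact: axis_idem ha.
- rewrite /P mul_Dr // mul_sg sx SE; apply: (form_ext br bC bpos) => z.
  by rewrite !bE; ring.
- rewrite /Q mul_Dr // mul_sg sx S2E; apply: (form_ext br bC bpos) => z.
  by rewrite !bE; ring.
- rewrite /P !mulE (axis_idem hb) sbsb (mulC (s b) b) bsb.
  by apply: (form_ext br bC bpos) => z; rewrite !bE; field.
- rewrite /P mulE bS sbS /Q; apply: (form_ext br bC bpos) => z.
  by rewrite !bE; field.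
- by rewrite -SE; apply: (axis_00 ha); exact: pa.
- by rewrite -SE; apply: (axis_04 ha); [exact: pa|exact: pb].
(* The rule for two 1/4-eigenvectors contributes a quarter of the squared norm of [part4], which the
   inner products above express by l and n. *)
rewrite -[X in mul X X]/(4 *: S + 16^-1 *: (b + s b) + (8^-1 - 4 * l) *: a) -SE.
rewrite (axis_44 ha pb pb) /part4 SE; congr (_ *: _).
rewrite !bE (bC S a) (bC S b) (bC S (s b)) (bC b a) (bC (s b) a) (bC (s b) b).
rewrite form_SS form_a_S form_b_S form_sb_S form_a_sb (axis_norm ha) (axis_norm hb).
by rewrite (axis_form ha) (axis_norm hb) lE nE; field.
Qed.

End Half.
Section Relation.
Variables (a b : M) (s t : M -> M).
Hypotheses (ha : axis a s) (hb : axis b t).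

(* Equating the formulas for S S seen from a and from b gives the relation; its
   inner products with a and b give (m - n) (1920 l + 303) = 0, and l >= 0. *)
Lemma dihedral_SS_flip (l m n : R) (S S2 Y : M) : form a b = l -> form a (t a) = m ->
    form b (s b) = n -> sg mul a b = S -> sg mul a (t a) = S2 -> sg mul b (s b) = Y ->
  n = m /\ dihedral_SS a (b + s b) (t a + s (t a)) S S2 Y l n =
           dihedral_SS b (a + t a) (s b + t (s b)) S Y S2 l m.
Proof.
move=> lE mE nE SE S2E YE.
have SE' : sg mul b a = S by rewrite -SE /sg mulC (addrC a).
have lE' : form b a = l by rewrite bC.
have [_ SSa] := dihedral_half ha hb lE nE SE S2E YE.
have [_ SSb] := dihedral_half hb ha lE' mE SE' YE S2E.
have E : dihedral_SS a (b + s b) (t a + s (t a)) S S2 Y l n =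
         dihedral_SS b (a + t a) (s b + t (s b)) S Y S2 l m by rewrite -SSa -SSb.
split=> //; have l0 : 0 <= l by rewrite -lE; exact: axis_form_ge0 ha (axis_idem hb).
have atsb : form b (s (t a)) = form a (t (s b)).
  by rewrite -(axis_form ha) (axis_inv ha) -(axis_form hb) (axis_inv hb) bC.
have asta : form a (s (t a)) = m by rewrite -mE -{1}(axis_fix ha) (axis_form ha).
have btsb : form b (t (s b)) = n by rewrite -nE -{1}(axis_fix hb) (axis_form hb).
have Sa := form_a_S ha lE SE. have Sb := form_a_S hb lE' SE'.
have S2a := form_a_S ha mE S2E. have Yb := form_a_S hb nE YE.
have Ya := form_a_Y ha hb lE nE SE YE. have S2b := form_a_Y hb ha lE' mE SE' S2E.
have := congr1 (form a) E; have := congr1 (form b) E; rewrite /dihedral_SS !bE.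
rewrite Sa Sb S2a S2b Ya Yb atsb asta btsb lE lE' mE nE.
rewrite (axis_norm ha) (axis_norm hb) (form_a_sb ha lE) (form_a_sb hb lE').
(* The number k = (a_0, a_3) = (a_1, a_-2) is unknown; adding the two equations eliminates it. *)
move: (form a (t (s b))) => k Eb Ea.
have : (m - n) * (60 * 32 * l + 303) = 0 by lra.
move=> /eqP; rewrite mulf_eq0 subr_eq0 => /orP[/eqP -> //|/eqP]; lra.
Qed.

Lemma axes_dihedral : form b (s b) = form a (t a) /\
  dihedral mul a b s t (form a b) (form a (t a)).
Proof.
have [nm E] := dihedral_SS_flip erefl erefl erefl erefl erefl erefl.
have [aY SS] := dihedral_half ha hb erefl erefl erefl erefl erefl.
have [b0 b4 sb] := axis_parts mul_lin br bC bpos ha b.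
have [t0 t4 st] := axis_parts mul_lin br bC bpos ha (t a).
split=> //; rewrite nm in aY SS E.
split=> //; [exact: axis_idem ha|exact: axis_lin ha|exact: axis_mul ha|exact: axis_inv ha
  |exact: axis_fix ha|exact: axis_00 ha|exact: axis_04 ha| |].
  (* The formula for a Y is a combination of a and the two 1/4-eigenvectors [part4], with
     coefficients read off at S, S2 and a. *)
  rewrite (mul_Dr mul_lin) (mul_Nr mul_lin) aY 2!(mul_Dr mul_lin) !(mul_Zr mul_lin).
  rewrite b4 t4 (axis_idem ha) /part4 /dihedral_aY /dihedral_r.
  by apply: (form_ext br bC bpos) => z; rewrite !bE; field.
move: E; move: (sg mul a b) (sg mul a (t a)) (sg mul b (s b)) => S S2 Y E.
move: (form a b) (form a (t a)) E => l m E.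
apply: (form_ext br bC bpos) => z; have := congr1 (form^~ z) E.
by rewrite /= /dihedral_SS !bE; lra.
Qed.

End Relation.

End TwoAxes.

(** * Closure of the span of eight vectors under multiplication *)

Section LinearSpan.
Variables (R : realType) (M : lmodType R).

Definition lspan (r : seq M) : set M :=
  [set x | exists c : nat -> R, x = \sum_(i < size r) c i *: r`_i].

Lemma lspan_subspace r : subspace (lspan r).
Proof.
split; first by exists (fun=> 0); rewrite big1 // => i _; rewrite scale0r.
move=> k x y [c ->] [d ->]; exists (fun i => k * c i + d i).
rewrite scaler_sumr -big_split /=.
by apply: eq_bigr => i _; rewrite scalerA -scalerDl.
Qed.

Lemma lspan_nth r i : (i < size r)%N -> lspan r r`_i.
Proof.
move=> ir; exists (fun j => (j == i)%:R); rewrite (bigD1 (Ordinal ir)) //= eqxx scale1r.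
rewrite big1 ?addr0 // => j /eqP ji; case: eqP => [E|_]; last by rewrite scale0r.
by case: ji; apply: val_inj.
Qed.

Lemma lspan_ind r (K : set M) : subspace K -> (forall i, (i < size r)%N -> K r`_i) ->
  lspan r `<=` K.
Proof.
move=> [K0 KD] Kr x [c ->]; elim/big_rec: _ => // i y _ Ky.
by apply: KD => //; apply: Kr.
Qed.

End LinearSpan.

Ltac in_subspace sG := repeat first
  [ assumption | apply: (subspace_D sG) | apply: (subspace_N sG) | apply: (subspace_Z sG _)].

Section Resurrection.
Variables (R : realType) (M : lmodType R) (mul : M -> M -> M).
Hypotheses (mul_lin : forall x, linear (mul x)) (mulC : forall x y, mul x y = mul y x).
Variable G : set M.
Hypothesis sG : subspace G.
Let mulE := algE mul_lin mulC.

Lemma subspace_ZI (c : R) x : c != 0 -> G (c *: x) -> G x.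
Proof. by move=> c0 /(subspace_Z sG c^-1); rewrite scalerA mulVf // scale1r. Qed.

Lemma subspace_DI x y : G x -> G (x + y) -> G y.
Proof.
move=> Gx Gxy; rewrite -[y](addKr x); apply: (subspace_D sG) Gxy.
exact: subspace_N.
Qed.

(* Modulo G, the products u w and v w are multiples of p q; the two fusion rules
   then force first a (p q) and next p q into G. *)
Lemma resurrection a p q u v w (c : R) : c != 0 ->
    (forall x, G x -> G (mul a x)) ->
    mul a (mul u w) = 0 -> mul a (mul v w) = 4^-1 *: mul v w ->
    (let gu := u + 4 *: p in let gv := v - 4 *: p in let gw := w - c *: q in
    [/\ G (mul p gw), G (mul q gu), G (mul q gv), G (mul gu gw) & G (mul gv gw)]) ->
  G (mul p q).
Proof.
move=> c0 aG uw vw [] /=; set gu := u + _; set gv := v - _; set gw := w - _.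
move=> pgw qgu qgv gugw gvgw.
have uE : u = gu - 4 *: p by rewrite addrK.
have vE : v = gv + 4 *: p by rewrite subrK.
have wE : w = gw + c *: q by rewrite subrK.
clearbody gu gv gw; rewrite uE vE wE !mulE (mulC gu q) (mulC gv q) in uw vw.
have c4 : 4 != 0 :> R by rewrite pnatr_eq0.
have apq : G (mul a (mul p q)).
  apply: (subspace_ZI c0); apply: (subspace_ZI c4).
  move: uw; rewrite addrA => /subr0_eq <-.
  by do ![apply: (subspace_D sG)|apply: (subspace_N sG)|apply: (subspace_Z sG _)|apply: aG].
apply: (subspace_ZI c0); apply: (subspace_ZI c4); apply: (@subspace_ZI 4^-1).
  by rewrite invr_eq0.
move: vw; rewrite !scalerDr !addrA => vw.
rewrite (canRL (addKr _) (esym vw)).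
by do ![assumption|apply: (subspace_D sG)|apply: (subspace_N sG)
  |apply: (subspace_Z sG _)|apply: aG].
Qed.

End Resurrection.

Section HalfClosure.
Variables (R : realType) (M : lmodType R) (mul : M -> M -> M).
Hypotheses (mul_lin : forall x, linear (mul x)) (mulC : forall x y, mul x y = mul y x).
Variable G : set M.
Hypothesis sG : subspace G.
Let mulE := algE mul_lin mulC.
Variables (a b : M) (s t : M -> M) (l m : R).
Hypothesis D : dihedral mul a b s t l m.
Local Notation S := (sg mul a b).
Local Notation S2 := (sg mul a (t a)).
Local Notation Y := (sg mul b (s b)).
Hypotheses (Ga : G a) (Gb : G b) (Gsb : G (s b)) (Gta : G (t a)) (Gsta : G (s (t a))).
Hypotheses (GS : G S) (GS2 : G S2) (GY : G Y).

Lemma dih_sD x y : s (x + y) = s x + s y.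
Proof. by have := dih_lin D 1 x y; rewrite !scale1r. Qed.

Lemma dih_s0 : s 0 = 0.
Proof. by apply: (@addrI _ (s 0)); rewrite -dih_sD !addr0. Qed.

Lemma dih_sZ c x : s (c *: x) = c *: s x.
Proof. by have := dih_lin D c x 0; rewrite !addr0 dih_s0 addr0. Qed.

Lemma dih_sN x : s (- x) = - s x.
Proof. by rewrite -scaleN1r dih_sZ scaleN1r. Qed.

Lemma dih_mul_sg x : mul a x = sg mul a x + 32^-1 *: (a + x).
Proof. by rewrite /sg subrK. Qed.

Lemma dih_mul_s x : s (sg mul a x) = sg mul a x ->
  mul a (s x) = sg mul a x + 32^-1 *: (a + s x).
Proof.
move=> sx; rewrite -{1}(dih_fix D) -(dih_mul D) dih_mul_sg.
by rewrite dih_sD sx dih_sZ dih_sD (dih_fix D).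
Qed.

Lemma half_mul : [/\ G (mul a a), G (mul a b), G (mul a (s b)), G (mul a (t a)) &
  G (mul a (s (t a)))] /\ [/\ G (mul a S), G (mul a S2) & G (mul a Y)].
Proof.
have Gab : G (mul a b) by rewrite dih_mul_sg; in_subspace sG.
have Gasb : G (mul a (s b)) by rewrite (dih_mul_s (dih_fixb D)); in_subspace sG.
have Gata : G (mul a (t a)) by rewrite dih_mul_sg; in_subspace sG.
have Gasta : G (mul a (s (t a))) by rewrite (dih_mul_s (dih_fixt D)); in_subspace sG.
have Gaa : G (mul a a) by rewrite (dih_idem D).
have c4 : 4 != 0 :> R by rewrite pnatr_eq0.
have GaS : G (mul a S).
  apply: (subspace_ZI sG c4); move: (dih_b0 D); rewrite /part0.
  rewrite (mul_Dr mul_lin) (mul_Dr mul_lin _ _ (- _)) (mul_Nr mul_lin) !(mul_Zr mul_lin).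
  rewrite addrAC => /subr0_eq <-; rewrite (mul_Dr mul_lin); in_subspace sG.
have GaS2 : G (mul a S2).
  apply: (subspace_ZI sG c4); move: (dih_t0 D); rewrite /part0.
  rewrite (mul_Dr mul_lin) (mul_Dr mul_lin _ _ (- _)) (mul_Nr mul_lin) !(mul_Zr mul_lin).
  rewrite addrAC => /subr0_eq <-; rewrite (mul_Dr mul_lin); in_subspace sG.
do 2!split => //; move: (dih_Y0 D).
rewrite (mul_Dr mul_lin) (mul_Nr mul_lin) => /subr0_eq ->.
rewrite 2!(mul_Dr mul_lin) !(mul_Zr mul_lin) (dih_b4 D) (dih_t4 D) (dih_idem D).
rewrite /part4; in_subspace sG.
Qed.

(** Apply [resurrection] with p = S2, where u and v are the two parts of t a. The pair w, q is in
    turn [part0] of b with S, [part0] of t a with S2, and the 0-part of Y with Y. *)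
Lemma half_S2 : (forall x, G x -> G (mul a x)) -> (forall x, G x -> G (mul b x)) ->
    (forall x, G x -> G (mul (s b) x)) -> (forall x, G x -> G (mul (t a) x)) ->
    (forall x, G x -> G (mul (s (t a)) x)) ->
  [/\ G (mul S2 S), G (mul S2 S2) & G (mul S2 Y)].
Proof.
move=> aG bG sbG taG staG.
pose gu := part0 mul a s m (t a) + 4 *: S2; pose gv := part4 mul a s m (t a) - 4 *: S2.
pose gb := part0 mul a s l b - (- 4) *: S; pose gc := part4 mul a s l b - 4 *: S.
have guE : gu = (7 / 16) *: (t a + s (t a)) + (3 * m - 8^-1) *: a.
  by rewrite /gu /part0 addrAC subrK.
have gbE : gb = (7 / 16) *: (b + s b) + (3 * l - 8^-1) *: a.
  by rewrite /gb /part0 scaleNr opprK addrAC subrK.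
have gvE : gv = 16^-1 *: (t a + s (t a)) + (8^-1 - 4 * m) *: a.
  by rewrite /gv /part4 addrAC [4 *: _ + _ - _]addrAC subrr add0r.
have gcE : gc = 16^-1 *: (b + s b) + (8^-1 - 4 * l) *: a.
  by rewrite /gc /part4 addrAC [4 *: _ + _ - _]addrAC subrr add0r.
have actu x : G x -> G (mul gu x) by move=> Gx; rewrite guE !mulE; in_subspace sG; auto.
have actb x : G x -> G (mul gb x) by move=> Gx; rewrite gbE !mulE; in_subspace sG; auto.
have actv x : G x -> G (mul gv x) by move=> Gx; rewrite gvE !mulE; in_subspace sG; auto.
have actc x : G x -> G (mul gc x) by move=> Gx; rewrite gcE !mulE; in_subspace sG; auto.
have Ggu : G gu by rewrite guE; in_subspace sG.
have Ggb : G gb by rewrite gbE; in_subspace sG.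
have t0 := dih_t0 D; have t4 := dih_t4 D.
have res q w (c : R) : c != 0 -> mul a w = 0 -> G q -> G (w - c *: q) ->
    G (mul S2 (w - c *: q)) -> G (mul S2 q).
  move=> c0 w0 Gq Gw GS2w; apply: (resurrection mul_lin mulC sG c0 aG
    (dih_00 D t0 w0) (_ : mul a (mul _ w) = 4^-1 *: mul _ w)).
    by rewrite !(mulC _ w); exact: (dih_04 D w0 t4).
  split; [exact: GS2w|rewrite mulC; exact: actu|rewrite mulC; exact: actv|exact: actu|exact: actv].
have n4 : - 4 != 0 :> R by rewrite oppr_eq0 pnatr_eq0.
have GS2S : G (mul S2 S).
  by apply: (res _ _ _ n4 (dih_b0 D)) => //; rewrite mulC; exact: actb.
have GS2S2 : G (mul S2 S2).
  have guE' : gu = part0 mul a s m (t a) - (- 4) *: S2 by rewrite scaleNr opprK.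
  by apply: (res _ _ _ n4 t0); rewrite -?guE' // mulC; exact: actu.
(* Here w - Y is a combination of a and the two [part4], so its product with S2 involves the two
   products just settled. *)
split=> //; apply: (res _ _ 1 (oner_neq0 _) (dih_Y0 D)) => //.
  rewrite scale1r addrAC subrr add0r /part4; in_subspace sG.
rewrite scale1r addrAC subrr add0r mulC.
rewrite -[part4 mul a s l b](subrK (4 *: S)) -/gc -[part4 mul a s m _](subrK (4 *: S2)) -/gv.
move: {res t0 t4} gc gv actc actv {gcE gvE} => gc gv actc actv.
rewrite (mul_Nl mul_lin mulC) 2!(mul_Dl mul_lin mulC) !(mul_Zl mul_lin mulC).
rewrite (mul_Dl mul_lin mulC gc) (mul_Dl mul_lin mulC gv) !(mul_Zl mul_lin mulC).
rewrite (mulC S S2); in_subspace sG; auto.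
Qed.

End HalfClosure.

Section Closure.
Variables (R : realType) (M : lmodType R) (mul : M -> M -> M).
Hypotheses (mul_lin : forall x, linear (mul x)) (mulC : forall x y, mul x y = mul y x).
Let mulE := algE mul_lin mulC.
Variables (a b : M) (s t : M -> M) (l m : R).
Hypotheses (D1 : dihedral mul a b s t l m) (D2 : dihedral mul b a t s l m).
Local Notation S := (sg mul a b).
Local Notation S2 := (sg mul a (t a)).
Local Notation Y := (sg mul b (s b)).

Definition dihedral_gens := [:: a; b; s b; t a; s (t a); S; S2; Y].
Local Notation G := (lspan dihedral_gens).

Let sG : subspace G. Proof. exact: lspan_subspace. Qed.

Lemma dihedral_gens_mem : [/\ G a, G b, G (s b), G (t a) & G (s (t a))] /\
  [/\ G S, G S2 & G Y].
Proof.
have g i (lt_i : (i < 8)%N) := @lspan_nth _ _ dihedral_gens i lt_i.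
split; split; [exact: (g 0%N)|exact: (g 1%N)|exact: (g 2%N)|exact: (g 3%N)|exact: (g 4%N)
  |exact: (g 5%N)|exact: (g 6%N)|exact: (g 7%N)].
Qed.

Lemma dihedral_span_ind (K : set M) : subspace K ->
  [/\ K a, K b, K (s b), K (t a) & K (s (t a))] -> [/\ K S, K S2 & K Y] -> G `<=` K.
Proof.
move=> sK [Ka Kb Ksb Kta Ksta] [KS KS2 KY]; apply: lspan_ind => //.
by case=> [|[|[|[|[|[|[|[|i]]]]]]]].
Qed.

Let sg_sym x y : sg mul x y = sg mul y x.
Proof. by rewrite /sg mulC (addrC x). Qed.

Let preim_subspace (f : M -> M) : linear f -> subspace [set x | G (f x)].
Proof.
move=> flin; split=> [|c x y /= Gx Gy]; last by rewrite flin; case: sG => _; apply.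
rewrite /=; suff -> : f 0 = 0 by case: sG.
by have := flin (- 1) 0 0; rewrite scaler0 addr0 scaleN1r addNr.
Qed.

(** This is the axis a_3, needed because exchanging a and b turns a_-2 = s (t a) into it. *)
Lemma dihedral_a3 : G (t (s b)).
Proof.
have [[Ga Gb Gsb Gta Gsta] [GS GS2 GY]] := dihedral_gens_mem.
move: Gsta; rewrite (dih_rel D1).
set x := _ *: (a + t a - _ - _); set y := _ *: (b - a); set z := 32 *: _ => H.
have DI u v : G v -> G (u + v) -> G u by move=> Gv; rewrite addrC; exact: subspace_DI.
apply: (subspace_DI sG Gsb); apply: (DI _ (- t a)); first exact: (subspace_N sG).
apply: (DI _ x); first by rewrite /x; in_subspace sG.
apply: (DI _ y); first by rewrite /y; in_subspace sG.
by apply: DI H; rewrite /z; in_subspace sG.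
Qed.

Lemma dihedral_s_stable x : G x -> G (s x).
Proof.
have [[Ga Gb Gsb Gta Gsta] [GS GS2 GY]] := dihedral_gens_mem.
apply: (@dihedral_span_ind [set x | G (s x)]); first exact: preim_subspace (dih_lin D1).
  by split=> //=; rewrite ?(dih_fix D1) ?(dih_inv D1).
split=> /=; first by rewrite (dih_fixb D1).
  by rewrite (dih_fixt D1).
rewrite /sg (dih_sD D1) (dih_sN D1) (dih_sZ D1) (dih_sD D1) (dih_mul D1) (dih_inv D1).
by rewrite -/(sg mul (s b) b) sg_sym.
Qed.

(** The critical generator is a_-2: applying t to [dih_rel] expresses its image by members of G,
    among them a_3. *)
Lemma dihedral_t_stable x : G x -> G (t x).
Proof.
have [[Ga Gb Gsb Gta Gsta] [GS GS2 GY]] := dihedral_gens_mem; have Ga3 := dihedral_a3.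
have tS : t S = S by rewrite sg_sym (dih_fixb D2).
have tS2 : t S2 = S2.
  rewrite /sg (dih_sD D2) (dih_sN D2) (dih_sZ D2) (dih_sD D2) (dih_mul D2) (dih_inv D2).
  by rewrite -/(sg mul (t a) a) sg_sym.
have tY : t Y = Y by rewrite (dih_fixt D2).
apply: (@dihedral_span_ind [set x | G (t x)]); first exact: preim_subspace (dih_lin D2).
  split=> //=; rewrite ?(dih_fix D2) ?(dih_inv D2) // (dih_rel D1).
  move: S2 Y tS2 tY GS2 GY => p q tp tq Gp Gq.
  rewrite !(dih_sD D2, dih_sN D2, dih_sZ D2) (dih_fix D2) !(dih_inv D2) tp tq.
  by in_subspace sG.
by split; rewrite /= ?tS ?tS2 ?tY.
Qed.

(** For b, [half_mul] with a and b exchanged covers a_3 in place of a_-2, and [dih_rel] makes up the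
    difference. The other axes are conjugates under s and t. *)
Lemma dihedral_axes_mul : [/\ forall x, G x -> G (mul a x), forall x, G x -> G (mul b x),
  forall x, G x -> G (mul (s b) x), forall x, G x -> G (mul (t a) x) &
  forall x, G x -> G (mul (s (t a)) x)].
Proof.
have [[Ga Gb Gsb Gta Gsta] [GS GS2 GY]] := dihedral_gens_mem; have Ga3 := dihedral_a3.
have GS' : G (sg mul b a) by rewrite sg_sym.
have mul_linear x : linear (mul x) by exact: mul_lin.
have aG x : G x -> G (mul a x).
  have [h1 h2] := half_mul mul_lin sG D1 Ga Gb Gsb Gta Gsta GS GS2.
  by apply: (@dihedral_span_ind [set x | G (mul a x)]); [exact: preim_subspace| |].
have bG x : G x -> G (mul b x).
  have [[bb ba bta bsb btsb] [bS bY bS2]] :=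
    half_mul mul_lin sG D2 Gb Ga Gta Gsb Ga3 GS' GY.
  apply: (@dihedral_span_ind [set x | G (mul b x)]);
    [exact: preim_subspace|split=> //=|split=> //=].
    rewrite (dih_rel D1); move: S2 Y bS2 bY => p q bp bq.
    by rewrite !(mul_Dr mul_lin, mul_Nr mul_lin, mul_Zr mul_lin); in_subspace sG.
  by rewrite sg_sym.
have taG x : G x -> G (mul (t a) x).
  move=> Gx; rewrite -[x](dih_inv D2) -(dih_mul D2); apply: dihedral_t_stable.
  by apply: aG; exact: dihedral_t_stable.
split=> // x Gx; rewrite -[x](dih_inv D1) -(dih_mul D1); apply: dihedral_s_stable.
  by apply: bG; exact: dihedral_s_stable.
by apply: taG; exact: dihedral_s_stable.
Qed.

(** The product S S is explicit. Products with S2 come from [half_S2], those with Y from the same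
    lemma with a and b exchanged. *)
Lemma dihedral_closed x y : G x -> G y -> G (mul x y).
Proof.
have [[Ga Gb Gsb Gta Gsta] [GS GS2 GY]] := dihedral_gens_mem; have Ga3 := dihedral_a3.
have [aG bG sbG taG staG] := dihedral_axes_mul.
have tsbG z : G z -> G (mul (t (s b)) z).
  move=> Gz; rewrite -[z](dih_inv D2) -(dih_mul D2); apply: dihedral_t_stable.
  by apply: sbG; exact: dihedral_t_stable.
have GS' : G (sg mul b a) by rewrite sg_sym.
have [S2S S2S2 S2Y] :=
  half_S2 mul_lin mulC sG D1 Ga Gb Gsb Gta Gsta GS GS2 GY aG bG sbG taG staG.
have [YS YY YS2] :=
  half_S2 mul_lin mulC sG D2 Gb Ga Gta Gsb Ga3 GS' GY GS2 bG aG taG sbG tsbG.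
have SS : G (mul S S) by rewrite (dih_SS D1) /dihedral_SS; in_subspace sG.
have mulr_linear z : linear (mul ^~ z) by move=> c u v; rewrite !(mulC _ z) mul_lin.
move=> Gx Gy; move: x Gx; apply: (@dihedral_span_ind [set x | G (mul x y)]).
  exact: (preim_subspace (mulr_linear y)).
  by split=> /=; auto.
have act v : G v -> G (mul v S) -> G (mul v S2) -> G (mul v Y) -> G (mul v y).
  move=> Gv vS vS2 vY; move: y Gy; apply: (@dihedral_span_ind [set z | G (mul v z)]).
  - by apply: preim_subspace; exact: mul_lin.
  - by split=> /=; rewrite (mulC v); auto.
  - by split.
have YS' : G (mul Y S) by rewrite (sg_sym a b).
by split=> /=; apply: act => //; rewrite mulC.
Qed.

(** To be applied to the difference of two forms, so F is not assumed definite. Zeros spread from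
    pairs of axes by associativity and invariance. *)
Lemma dihedral_form0 (F : M -> M -> R) : (forall x, scalar (F x)) ->
    (forall x y, F x y = F y x) -> (forall x y z, F (mul x y) z = F x (mul y z)) ->
    (forall x y, F (s x) (s y) = F x y) -> (forall x y, F (t x) (t y) = F x y) ->
    F a a = 0 -> F b b = 0 -> F a b = 0 -> F a (t a) = 0 -> F b (s b) = 0 ->
  forall x y, G x -> G y -> F x y = 0.
Proof.
move=> Flin FC FA Fs Ft Faa Fbb Fab Fata Fbsb.
have FE := formE Flin FC.
have Fker v : subspace [set x | F v x = 0].
  split=> [|c x y /= vx vy]; first by rewrite /= (form_0r Flin).
  by rewrite !FE vx vy mulr0 addr0.
have Fba : F b a = 0 by rewrite FC.
have Fasb : F a (s b) = 0 by rewrite -(dih_fix D1) Fs.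
have Fasta : F a (s (t a)) = 0 by rewrite -{1}(dih_fix D1) Fs.
have Fbta : F b (t a) = 0 by rewrite -(dih_fix D2) Ft.
have Fsg x y : F x x = 0 -> F x y = 0 -> mul x x = x -> F x (sg mul x y) = 0.
  by move=> xx xy idx; rewrite /sg !FE -FA idx xx xy; ring.
have FaS := Fsg _ _ Faa Fab (dih_idem D1).
have FbS : F b S = 0 by rewrite sg_sym; apply: Fsg (dih_idem D2).
have FaS2 := Fsg _ _ Faa Fata (dih_idem D1).
have FbY := Fsg _ _ Fbb Fbsb (dih_idem D2).
have FSsb : F S (s b) = 0 by rewrite -(dih_fixb D1) Fs FC.
have FSta : F S (t a) = 0 by rewrite sg_sym -(dih_fixb D2) Ft sg_sym FC.
have abE : mul a b = S + 32^-1 *: (a + b) by rewrite /sg subrK.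
have FaY : F a Y = 0.
  rewrite {1}/sg !FE -FA abE; move: (S) FSsb => p pE.
  by rewrite !FE pE Fab Fasb Fbsb; ring.
have FbS2 : F b S2 = 0.
  rewrite {1}/sg !FE -FA mulC abE; move: (S) FSta => p pE.
  by rewrite !FE pE Fba Fata Fbta; ring.
have Fbtsb : F b (t (s b)) = 0 by rewrite -{1}(dih_fix D2) Ft.
(* The value at (a_1, a_-2) is not a translate of a given one; it follows from the linear
   relation. *)
have Fbsta : F b (s (t a)) = 0.
  rewrite (dih_rel D1); move: S2 Y FbS2 FbY => p q pE qE.
  by rewrite !FE pE qE Fbb Fba Fbsb Fbta Fbtsb; ring.
have [aG bG sbG taG staG] := dihedral_axes_mul.
have Fa y : G y -> F a y = 0 by apply: (dihedral_span_ind (Fker a)).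
have Fb y : G y -> F b y = 0 by apply: (dihedral_span_ind (Fker b)).
have Fsb y : G y -> F (s b) y = 0.
  by move=> Gy; rewrite -[y](dih_inv D1) Fs; apply/Fb/dihedral_s_stable.
have Fta y : G y -> F (t a) y = 0.
  by move=> Gy; rewrite -[y](dih_inv D2) Ft; apply/Fa/dihedral_t_stable.
have Fsta y : G y -> F (s (t a)) y = 0.
  by move=> Gy; rewrite -[y](dih_inv D1) Fs; apply/Fta/dihedral_s_stable.
move=> x y Gx Gy; rewrite FC; move: x Gx; apply: (dihedral_span_ind (Fker y)).
  by split; rewrite /= FC; auto.
(* Associativity moves one factor of the product defining S, S2 or Y to the other side, which leaves
   only axes. *)
split; rewrite /= FC /sg !FE !FA.
- by rewrite !(Fa, Fb); auto; ring.
- by rewrite !(Fa, Fta); auto; ring.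
- by rewrite !(Fb, Fsb); auto; ring.
Qed.

End Closure.

(** * The Griess algebra *)

Section Pairs.
Variables (R : realType) (M M' : lmodType R).
Variables (mul : M -> M -> M) (mul' : M' -> M' -> M').

Definition pmul (x y : M * M') : M * M' := (mul x.1 y.1, mul' x.2 y.2).
Definition pmap (s : M -> M) (s' : M' -> M') (x : M * M') : M * M' := (s x.1, s' x.2).

(** Each field is an equation, or an implication between equations, with the same coefficients in
    both factors, hence holds componentwise. *)
Lemma dihedral_pair a b s t a' b' s' t' l m :
    dihedral mul a b s t l m -> dihedral mul' a' b' s' t' l m ->
  dihedral pmul (a, a') (b, b') (pmap s s') (pmap t t') l m.
Proof.
move=> D D'; split.
- by congr (_, _); [exact: dih_idem D|exact: dih_idem D'].
- by move=> c x y; congr (_, _); [exact: dih_lin D _ _ _|exact: dih_lin D' _ _ _].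
- by move=> x y; congr (_, _); [exact: dih_mul D _ _|exact: dih_mul D' _ _].
- by move=> [x y]; congr (_, _); [exact: dih_inv D _|exact: dih_inv D' _].
- by congr (_, _); [exact: dih_fix D|exact: dih_fix D'].
- by congr (_, _); [exact: dih_fixb D|exact: dih_fixb D'].
- by congr (_, _); [exact: dih_fixt D|exact: dih_fixt D'].
- move=> [x x'] [y y'] [ax ax'] [ay ay'].
  by congr (_, _); [exact: dih_00 D _ _ ax ay|exact: dih_00 D' _ _ ax' ay'].
- move=> [x x'] [y y'] [ax ax'] [ay ay'].
  by congr (_, _); [exact: dih_04 D _ _ ax ay|exact: dih_04 D' _ _ ax' ay'].
- by congr (_, _); [exact: dih_b0 D|exact: dih_b0 D'].
- by congr (_, _); [exact: dih_b4 D|exact: dih_b4 D'].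
- by congr (_, _); [exact: dih_t0 D|exact: dih_t0 D'].
- by congr (_, _); [exact: dih_t4 D|exact: dih_t4 D'].
- by congr (_, _); [exact: dih_Y0 D|exact: dih_Y0 D'].
- by congr (_, _); [exact: dih_SS D|exact: dih_SS D'].
- by apply: injective_projections; [exact: dih_rel D|exact: dih_rel D'].
Qed.

End Pairs.

Section GriessType.
Variables (R : realType) (V : voa R).

(** Makes V_2 a module type of its own, with the total product and form that the sections on axes
    quantify over. *)
Definition weight2 : {pred V} := fun x => `[< grade V 2 x >].

Lemma weight2_submod : submod_closed weight2.
Proof.
split=> [|c x y]; rewrite !unfold_in; first by apply/asboolP; exact: grade0.
by move=> /asboolP x2 /asboolP y2; apply/asboolP; exact: gradeD.
Qed.

HB.instance Definition _ := GRing.isSubmodClosed.Build R V weight2 weight2_submod.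

Record griess := Griess { gval :> V; gvalP : gval \in weight2 }.
HB.instance Definition _ := [isSub for gval].
HB.instance Definition _ := [Choice of griess by <:].
HB.instance Definition _ := [SubChoice_isSubLmodule of griess by <:].

Lemma griessP (x : griess) : grade V 2 (gval x).
Proof. exact/asboolP/(gvalP x). Qed.

Definition to_griess x (x2 : grade V 2 x) : griess := Griess (asboolT x2).

End GriessType.

Lemma griess_forbidden (R : realType) :
  [/\ forbidden 0 0 (1 / 2 : R), forbidden 0 0 (1 / 16 : R),
      forbidden 0 (1 / 2 : R) 0, forbidden 0 (1 / 2 : R) (1 / 16) &
      forbidden (1 / 2 : R) (1 / 2) (1 / 2) /\ forbidden (1 / 2 : R) (1 / 2) (1 / 16)].
Proof.
by repeat split; rewrite /forbidden /=;
  first [by left; split=> [|?]; lra|by right; split=> [|?]; lra].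
Qed.

Section GriessAlgebra.
Variables (R : realType) (V : voa R) (b : V -> V -> R).
Hypotheses (hV : standing V) (hb : adjoint_form b).
Local Notation B := (griess V).
Implicit Types x y z : B.

Let br : forall u, scalar (b u). Proof. by case: hb. Qed.
Let bC : forall u v, b u v = b v u. Proof. by case: hb. Qed.
Let bpos : forall v, v != 0 -> 0 < b v v. Proof. by case: hb. Qed.
Let bE := formE br bC.

Lemma gval_inj : injective (@gval R V).
Proof. exact: val_inj. Qed.

Lemma gvalD c x y : gval (c *: x + y) = c *: gval x + gval y.
Proof. by []. Qed.

Lemma griess_grade x y : grade V 2 (2^-1 *: nprod 1 (gval x) (gval y)).
Proof. by apply/gradeZ/(nprod_grade (griessP x) (griessP y)). Qed.

(* The rescaling turns an Ising vector into an idempotent of norm one. *)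
Definition gmul x y : B := to_griess (griess_grade x y).
Definition gform x y : R := 4 * b (gval x) (gval y).

Lemma gmul_lin x : linear (gmul x).
Proof.
move=> c y z; apply: gval_inj; rewrite gvalD /= !nprodE.
by rewrite scalerDr !scalerA mulrC.
Qed.

Lemma gmulC x y : gmul x y = gmul y x.
Proof.
by apply: gval_inj; rewrite /= (griess_mulC hV hb (griessP x) (griessP y)).
Qed.

Lemma gform_lin x : scalar (gform x).
Proof. by move=> c y z; rewrite /gform gvalD !bE; ring. Qed.

Lemma gformC x y : gform x y = gform y x.
Proof. by rewrite /gform bC. Qed.

Lemma gform_pos x : x != 0 -> 0 < gform x x.
Proof. by move=> x0; rewrite /gform pmulr_rgt0 // bpos // (inj_eq gval_inj x 0). Qed.

Lemma gformA x y z : gform (gmul x y) z = gform x (gmul y z).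
Proof.
rewrite /gform /= !bE (griess_mulC hV hb (griessP x) (griessP y)).
by rewrite (adjoint_mode hb _ _ _ (griessP y)).
Qed.

Let gE := formE gform_lin gformC.
Let mE := algE gmul_lin gmulC.

(** For a conformal vector a the default 0 is never taken, by [tau_grade2]. *)
Definition gtau (a : V) x : B := insubd 0 (tau a (gval x)).

Section Axis.
Variable a : B.
Hypothesis ha : conformal_vector (1 / 2%:R) (gval a).

Lemma tau_grade2 u : grade V 2 u -> grade V 2 (tau (gval a) u).
Proof.
move=> u2; have [[tlin _ tn _ tc] _ _ _] := tauP hV hb ha.
have tZ c v : tau (gval a) (c *: v) = c *: tau (gval a) v.
  have t0 : tau (gval a) 0 = 0.
    by have := tlin (-1) 0 0; rewrite scaler0 addr0 scaleN1r addNr.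
  by have := tlin c v 0; rewrite !addr0 t0 addr0.
have : nprod 1 (conf V) (tau (gval a) u) = 2%:Z%:~R *: tau (gval a) u.
  by rewrite -{1}tc -tn (grade_L0 u2) tZ.
by case/L0_eigen_grade => [->|[k /= [<-]]] //; exact: grade0.
Qed.

Lemma gtauE x : gval (gtau (gval a) x) = tau (gval a) (gval x).
Proof. by rewrite /gtau; apply: insubdK; apply/asboolP/tau_grade2/griessP. Qed.

Let ga2 := griessP a.

Lemma gmul_hw c x : c != 1 -> gmul a x = c *: x -> hw (gval a) (2 * c) (gval x).
Proof.
move=> c1 /(congr1 (@gval R V)) /= ax.
have ax1 : nprod 1 (gval a) (gval x) = (2 * c) *: gval x.
  by rewrite -scalerA -[c *: _]ax scalerA mulfV ?scale1r // pnatr_eq0.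
split=> //; apply: (singular_orthogonal hV hb ha (griessP x)).
have aa : nprod 1 (gval a) (gval a) = 2 *: gval a by case: ha.
have := adjoint_mode hb 1 (gval a) (gval x) ga2; rewrite aa (_ : 2 - 1 = 1) // ax1 !bE.
move/eqP; rewrite -subr_eq0 -mulrBl mulf_eq0 => /orP[|/eqP //].
by rewrite -{1}[2]mulr1 -mulrBr mulf_eq0 pnatr_eq0 subr_eq0 [1 == c]eq_sym (negPf c1).
Qed.

Lemma hw_gmul c x : hw (gval a) (2 * c) (gval x) -> gmul a x = c *: x.
Proof.
move=> [_ ax]; apply: gval_inj; rewrite /= ax scalerA mulKf ?pnatr_eq0 //.
Qed.

Lemma hw_gmul_self : gmul a a = 1 *: a.
Proof.
have aa : nprod 1 (gval a) (gval a) = 2 *: gval a by case: ha.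
by apply: gval_inj; rewrite /= aa scalerA mulVf // pnatr_eq0.
Qed.

Lemma griess_dec x : exists u v w : B, x = gform a x *: a + u + v + w /\
  [/\ hw (gval a) 0 (gval u), hw (gval a) (1 / 2) (gval v) & hw (gval a) (1 / 16) (gval w)].
Proof.
pose y := x - gform a x *: a.
have ay : b (gval a) (gval y) = 0.
  by rewrite /y addrC -scaleNr gvalD !bE (conformal_form hV hb ha) /gform; field.
have [v0 [v1 [v2 [E h0 h1 h2 gr]]]] :=
  singular_decomp hV hb ha (singular_orthogonal hV hb ha (griessP y) ay).
have [g0 g1 g2] := gr 2%N (griessP y).
exists (to_griess g0), (to_griess g1), (to_griess g2); split=> //.
have Ey : y = to_griess g0 + to_griess g1 + to_griess g2 by apply: gval_inj; exact: E.
by rewrite -[LHS](subrK (gform a x *: a)) -/y Ey addrC !addrA.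
Qed.

(** A component of forbidden weight is orthogonal to p by fusion and to the other components by
    their eigenvalues, hence to itself. *)
Lemma fusion_dec h1 h2 x y : hw (gval a) h1 (gval x) -> hw (gval a) h2 (gval y) ->
  let p := gmul x y in exists u v w : B, p = gform a p *: a + u + v + w /\
  [/\ gmul a u = 0, gmul a v = 4^-1 *: v & gmul a w = 32^-1 *: w] /\
  [/\ forbidden h1 h2 0 -> u = 0, forbidden h1 h2 (1 / 2) -> v = 0 &
      forbidden h1 h2 (1 / 16) -> w = 0].
Proof.
move=> hx hy p; have [u [v [w [E [hu hv hw']]]]] := griess_dec p.
have eig c z : hw (gval a) (2 * c) (gval z) -> gmul a z = c *: z by exact: hw_gmul.
have au : gmul a u = 0 *: u by apply: eig; rewrite mulr0.
have av : gmul a v = 4^-1 *: v by apply: eig; rewrite (_ : 2 / 4 = 1 / 2) //; field.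
have aw : gmul a w = 32^-1 *: w by apply: eig; rewrite (_ : 2 / 32 = 1 / 16) //; field.
exists u, v, w; split=> //; split; first by rewrite au scale0r.
have orth c d z t : gmul a z = c *: z -> gmul a t = d *: t -> c != d -> gform z t = 0.
  move=> az at' cd; have := gformA z a t; rewrite gmulC az at' !gE => /eqP.
  by rewrite -subr_eq0 -mulrBl mulf_eq0 subr_eq0 (negPf cd) => /eqP.
have aa : gmul a a = 1 *: a.
  exact: hw_gmul_self.
have ua : gform u a = 0 by apply: orth au aa _; apply/eqP; lra.
have va : gform v a = 0 by apply: orth av aa _; apply/eqP; lra.
have wa : gform w a = 0 by apply: orth aw aa _; apply/eqP; lra.
have uv : gform u v = 0 by apply: orth au av _; apply/eqP; lra.
have uw : gform u w = 0 by apply: orth au aw _; apply/eqP; lra.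
have vw : gform v w = 0 by apply: orth av aw _; apply/eqP; lra.
have fus h z : hw (gval a) h (gval z) -> forbidden h1 h2 h -> gform z p = 0.
  move=> hz fb; rewrite /gform /p /= (form_Zr br).
  by rewrite (fusion_eq0 hV hb ha 1 fb hx hy hz) !mulr0.
split=> fb; apply: (form_eq0 gform_pos).
- have := fus _ _ hu fb; rewrite {1}E; move: (gform a p) => k.
  by rewrite !gE ua uv uw mulr0 !addr0 add0r.
- have := fus _ _ hv fb; rewrite {1}E; move: (gform a p) => k.
  by rewrite !gE va (gformC v u) uv vw mulr0 !addr0 !add0r.
- have := fus _ _ hw' fb; rewrite {1}E; move: (gform a p) => k.
  by rewrite !gE wa (gformC w u) uw (gformC w v) vw mulr0 !add0r.
Qed.

Let eig0 x : gmul a x = 0 -> hw (gval a) 0 (gval x).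
Proof.
by move=> ax; rewrite -[0 : R](mulr0 2); apply: gmul_hw; rewrite ?scale0r // eq_sym oner_neq0.
Qed.

Let eig4 x : gmul a x = 4^-1 *: x -> hw (gval a) (1 / 2) (gval x).
Proof.
move=> ax; rewrite (_ : 1 / 2 = 2 * 4^-1); last by field.
by apply: gmul_hw => //; apply/eqP; lra.
Qed.

Let eig32 x : gmul a x = 32^-1 *: x -> hw (gval a) (1 / 16) (gval x).
Proof.
move=> ax; rewrite (_ : 1 / 16 = 2 * 32^-1); last by field.
by apply: gmul_hw => //; apply/eqP; lra.
Qed.

Lemma griess_axis : axis gmul gform a (gtau (gval a)).
Proof.
have [[tlin _ tn tv _] _ _ _] := tauP hV hb ha.
have th x := tau_hw hV hb ha (gval x).
have [f1 f2 f3 f4 [f5 f6]] := griess_forbidden R.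
split.
- by rewrite hw_gmul_self scale1r.
- by rewrite /gform (conformal_form hV hb ha) mulfV // pnatr_eq0.
- move=> x; have [u [v [w [E [hu hv hw']]]]] := griess_dec x; exists u, v, w; split=> //.
  + by rewrite (@hw_gmul 0) ?scale0r // mulr0.
  + by apply: hw_gmul; rewrite (_ : 2 / 4 = 1 / 2) //; field.
  + by apply: hw_gmul; rewrite (_ : 2 / 32 = 1 / 16) //; field.
- move=> x y ax ay.
  have [u [v [w [E [[au _ _] [_ v0 w0]]]]]] := fusion_dec (eig0 ax) (eig0 ay).
  have l0 : gform a (gmul x y) = 0 by rewrite -gformA ax !gE.
  by rewrite E v0 ?w0 ?l0 ?scale0r ?add0r ?addr0.
- move=> x y ax ay.
  have [u [v [w [E [[_ av _] [u0 _ w0]]]]]] := fusion_dec (eig0 ax) (eig4 ay).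
  have l0 : gform a (gmul x y) = 0 by rewrite -gformA ax !gE.
  by rewrite E u0 ?w0 ?l0 ?scale0r ?add0r ?addr0.
- move=> x y ax ay.
  have [u [v [w [E [[au _ _] [_ v0 w0]]]]]] := fusion_dec (eig4 ax) (eig4 ay).
  have l0 : gform a (gmul x y) = gform x y / 4 by rewrite -gformA ax !gE mulrC.
  by rewrite {1}E l0 v0 ?w0 ?addr0 // !mE au addr0 hw_gmul_self scale1r.
- move=> c x y; apply: gval_inj; rewrite gtauE gvalD (gvalD c (gtau _ _)) !gtauE.
  exact: tlin.
- move=> x y; apply: gval_inj; rewrite gtauE /= !gtauE -tn.
  have t0 : tau (gval a) 0 = 0.
    by have := tlin (-1) 0 0; rewrite scaler0 addr0 scaleN1r addNr.
  by have := tlin 2^-1 (nprod 1 (gval x) (gval y)) 0; rewrite !addr0 t0 addr0.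
(* The form is preserved because x_(3) y = (x, y) 1 and the vacuum is fixed. *)
- move=> x y; rewrite /gform !gtauE; congr (_ * _).
  have := tn 3 (gval x) (gval y).
  have gx := tau_grade2 (griessP x); have gy := tau_grade2 (griessP y).
  rewrite (weight2_mode3 hV hb (griessP x) (griessP y)) (weight2_mode3 hV hb gx gy).
  have := tlin (b (gval x) (gval y)) (vac V) 0; rewrite addr0 => ->.
  have -> : tau (gval a) 0 = 0.
    by have := tlin (-1) 0 0; rewrite scaler0 addr0 scaleN1r addNr.
  rewrite tv addr0 => /(congr1 (b (vac V))); rewrite !(form_Zr br).
  by case: hb => _ _ _ _ ->; rewrite !mulr1.
- by move=> x; apply: gval_inj; rewrite !gtauE (tau_involutive hV hb ha).
- by apply: gval_inj; rewrite gtauE (tau_self hV hb ha).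
- move=> x /eig0 hx; apply: gval_inj; rewrite gtauE; by have [f _ _] := th x; exact: f.
- move=> x /eig4 hx; apply: gval_inj; rewrite gtauE; by have [_ f _] := th x; exact: f.
- move=> x /eig32 hx; apply: gval_inj; rewrite gtauE; by have [_ _ f] := th x; exact: f.
Qed.

End Axis.
End GriessAlgebra.

Section IsingPair.
Variables (R : realType) (V : voa R) (b : V -> V -> R) (e f : griess V).
Hypotheses (hV : standing V) (hb : adjoint_form b).
Hypotheses (he : conformal_vector (1 / 2%:R) (gval e)).
Hypotheses (hf : conformal_vector (1 / 2%:R) (gval f)).
Local Notation s := (gtau (gval e)).
Local Notation t := (gtau (gval f)).
Local Notation mul := (@gmul R V).
Local Notation form := (gform b).

Let bC : forall u v, b u v = b v u. Proof. by case: hb. Qed.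

Lemma norm_form_gform (x : griess V) : norm_form (gval e) (gval x) = form e x.
Proof.
have bE := griess_form_adjoint hV hb.
rewrite /norm_form (bE _ _ (griessP e) (griessP x)) (bE _ _ (griessP e) (griessP e)) /gform.
by rewrite (conformal_form hV hb he) invrK mulrC.
Qed.

Lemma ising_dihedral : form f (s f) = form e (t e) /\
  dihedral mul e f s t (form e f) (form e (t e)) /\
  dihedral mul f e t s (form e f) (form e (t e)).
Proof.
have ae := griess_axis hV hb he; have af := griess_axis hV hb hf.
have [nm D] := axes_dihedral (@gmul_lin R V) (gmulC hV hb) (gform_lin hb) (gformC hb)
  (gform_pos hb) (gformA hV hb) ae af.
have [_ D'] := axes_dihedral (@gmul_lin R V) (gmulC hV hb) (gform_lin hb) (gformC hb)
  (gform_pos hb) (gformA hV hb) af ae.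
by split=> //; split=> //; rewrite nm (gformC hb f) in D'.
Qed.

(** The subalgebra is generated without involutions, but [axis_mul_sg] writes the image of x through
    products of e and x. *)
Lemma griess_gen_s (x : griess V) : griess_gen (gval e) (gval f) (gval x) ->
  griess_gen (gval e) (gval f) (gval (s x)).
Proof.
move=> Wx W WP; have {Wx} Wx := Wx W WP; case: WP => [[sW _ Wm] Wef].
have We : W (gval e) by apply: Wef; left.
pose K := [set y : griess V | W (gval y)].
have sK : subspace K by case: sW => W0 WD; split => // c y z; exact: WD.
have Km y z : K y -> K z -> K (gmul y z).
  by move=> Ky Kz; apply: (subspace_Z sW _); exact: Wm.
have Ksg : K (sg mul e x).
  by rewrite /sg; in_subspace sK; apply: Km.
have ae := griess_axis hV hb he.
have := axis_mul_sg (@gmul_lin R V) (gform_lin hb) (gformC hb) (gform_pos hb) ae x.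
move: (sg mul e x) Ksg => p Kp E.
have : K (mul e p) by exact: Km.
rewrite E addrAC => H; apply: (subspace_DI sK (_ : K x)) => //.
have c0 : (7 / (64 * 32) : R) != 0 by rewrite mulf_neq0 ?invr_eq0 ?mulf_neq0 ?pnatr_eq0.
apply: (subspace_ZI sK c0); apply: (subspace_DI sK _ H).
by in_subspace sK.
Qed.

End IsingPair.

Lemma griess_genC (R : realType) (V : voa R) (e f : V) : griess_gen e f = griess_gen f e.
Proof. by rewrite /griess_gen setUC. Qed.

Lemma griess_gen_subalgebra (R : realType) (V : voa R) (e f : V) :
  grade V 2 e -> grade V 2 f -> griess_subalgebra (griess_gen e f).
Proof.
move=> e2 f2; split.
- split=> [W [[[W0 _] _ _] _] //|c x y Wx Wy W WP].
  by have [[[_ WD] _ _] _] := WP; apply: WD; [exact: Wx|exact: Wy].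
- apply: smallest_sub => [|_ [->|->] //]; split => //; first exact: grade_subspace.
  by move=> x y x2 y2; exact: (nprod_grade x2 y2).
- move=> x y Wx Wy W WP; have [[_ _ Wm] _] := WP.
  by apply: Wm; [exact: Wx|exact: Wy].
Qed.

(** * The graph of the isomorphism *)

Section Comparison.
Variables (R : realType) (V V' : voa R) (b : V -> V -> R) (b' : V' -> V' -> R).
Variables (e f : griess V) (e' f' : griess V').
Hypotheses (hV : standing V) (hb : adjoint_form b).
Hypotheses (hV' : standing V') (hb' : adjoint_form b').
Hypotheses (he : conformal_vector (1 / 2%:R) (gval e)).
Hypotheses (hf : conformal_vector (1 / 2%:R) (gval f)).
Hypotheses (he' : conformal_vector (1 / 2%:R) (gval e')).
Hypotheses (hf' : conformal_vector (1 / 2%:R) (gval f')).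
Hypothesis l_eq : gform b' e' f' = gform b e f.
Hypothesis m_eq : gform b' e' (gtau (gval f') e') = gform b e (gtau (gval f) e).

Local Notation mul := (pmul (@gmul R V) (@gmul R V')).
Local Notation s := (pmap (gtau (gval e)) (gtau (gval e'))).
Local Notation t := (pmap (gtau (gval f)) (gtau (gval f'))).
Local Notation a := (e, e').
Local Notation c := (f, f').

Definition gens := dihedral_gens mul a c s t.
(* Shown to be the graph of an isomorphism of the algebras generated by e, f and
   by e', f'. *)
Definition graph : set (griess V * griess V') := lspan gens.

Let mul_lin x : linear (mul x).
Proof. by move=> k y z; congr (_, _); exact: gmul_lin. Qed.

Let mulC x y : mul x y = mul y x.
Proof. by congr (_, _); [exact: gmulC hV hb _ _|exact: gmulC hV' hb' _ _]. Qed.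

Let D1 : dihedral mul a c s t (gform b e f) (gform b e (gtau (gval f) e)).
Proof.
have [_ [D _]] := ising_dihedral hV hb he hf.
have [_ [D' _]] := ising_dihedral hV' hb' he' hf'.
by apply: dihedral_pair => //; rewrite -m_eq -l_eq.
Qed.

Let D2 : dihedral mul c a t s (gform b e f) (gform b e (gtau (gval f) e)).
Proof.
have [_ [_ D]] := ising_dihedral hV hb he hf.
have [_ [_ D']] := ising_dihedral hV' hb' he' hf'.
by apply: dihedral_pair => //; rewrite -m_eq -l_eq.
Qed.

Lemma graph_closed x y : graph x -> graph y -> graph (mul x y).
Proof. exact: (dihedral_closed mul_lin mulC D1 D2). Qed.

Lemma graph_form x y : graph x -> graph y -> gform b x.1 y.1 = gform b' x.2 y.2.
Proof.
pose F (x y : griess V * griess V') := gform b x.1 y.1 - gform b' x.2 y.2.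
move=> Gx Gy; apply/eqP; rewrite -subr_eq0; apply/eqP; rewrite -/(F x y).
have [ae ae'] := (griess_axis hV hb he, griess_axis hV' hb' he').
have [af af'] := (griess_axis hV hb hf, griess_axis hV' hb' hf').
have [nm _] := ising_dihedral hV hb he hf.
have [nm' _] := ising_dihedral hV' hb' he' hf'.
apply: (dihedral_form0 mul_lin mulC D1 D2 (F := F)) => //; rewrite /F /=.
- by move=> z k u v /=; rewrite (gform_lin hb) (gform_lin hb') /=; ring.
- by move=> u v; rewrite (gformC hb) (gformC hb').
- by move=> u v w; rewrite (gformA hV hb) (gformA hV' hb').
- by move=> u v; rewrite (axis_form ae) (axis_form ae').
- by move=> u v; rewrite (axis_form af) (axis_form af').
- by rewrite (axis_norm ae) (axis_norm ae') subrr.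
- by rewrite (axis_norm af) (axis_norm af') subrr.
- by rewrite l_eq subrr.
- by rewrite m_eq subrr.
- by rewrite nm nm' m_eq subrr.
Qed.

Local Notation W := (griess_gen (gval e) (gval f)).
Local Notation W' := (griess_gen (gval e') (gval f')).

Lemma graph_sub z : graph z -> W (gval z.1) /\ W' (gval z.2).
Proof.
have sW := griess_gen_subalgebra (griessP e) (griessP f).
have sW' := griess_gen_subalgebra (griessP e') (griessP f').
have [[W0 WD] _ Wm] := sW; have [[W'0 W'D] _ W'm] := sW'.
pose K := [set z : griess V * griess V' | W (gval z.1) /\ W' (gval z.2)].
have sK : subspace K.
  by split=> [|k x y [Wx W'x] [Wy W'y]]; [split|split; [exact: WD|exact: W'D]].
have Ks x : K x -> K (s x).
  by move=> [Wx W'x]; split; [exact: (griess_gen_s hV hb he)|exact: (griess_gen_s hV' hb' he')].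
have Kt x : K x -> K (t x).
  move=> [Wx W'x]; split; rewrite griess_genC.
    by apply: (griess_gen_s hV hb hf); rewrite griess_genC.
  by apply: (griess_gen_s hV' hb' hf'); rewrite griess_genC.
have Km x y : K x -> K y -> K (mul x y).
  move=> [Wx W'x] [Wy W'y].
  by split; [apply: (subspace_Z (_ : subspace W) _); [by []|exact: Wm]
    |apply: (subspace_Z (_ : subspace W') _); [by []|exact: W'm]].
have Ka : K a by split=> U [_]; apply; left.
have Kc : K c by split=> U [_]; apply; right.
have Ksg x y : K x -> K y -> K (sg mul x y).
  by move=> Kx Ky; rewrite /sg; in_subspace sK; exact: Km.
by apply: (dihedral_span_ind sK); split; auto 6.
Qed.

(** The first projection of the graph is a subalgebra containing e and f; the factor 2 below undoes
    the rescaling of the product. *)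
Lemma graph_surj v : W v -> exists2 z, graph z & v = gval z.1.
Proof.
have [[G0 GD] [[Ga Gc _ _ _] _]] := (lspan_subspace gens, dihedral_gens_mem mul a c s t).
move: v; apply: (@smallest_sub _ _ _ [set v | exists2 z, graph z & v = gval z.1]).
  split.
  - split=> [|k _ _ [x Gx ->] [y Gy ->]]; first by exists 0.
    by exists (k *: x + y) => //; exact: GD.
  - by move=> _ [x _ ->]; exact: griessP.
  - move=> _ _ [x Gx ->] [y Gy ->]; exists (2 *: mul x y).
      exact/(subspace_Z (lspan_subspace _) _)/graph_closed.
    by rewrite /= /griess_mul scalerA mulfV ?scale1r // pnatr_eq0.
by move=> _ [->|->]; [exists a|exists c].
Qed.

Lemma graph_surj' v : W' v -> exists2 z, graph z & v = gval z.2.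
Proof.
have [[G0 GD] [[Ga Gc _ _ _] _]] := (lspan_subspace gens, dihedral_gens_mem mul a c s t).
move: v; apply: (@smallest_sub _ _ _ [set v | exists2 z, graph z & v = gval z.2]).
  split.
  - split=> [|k _ _ [x Gx ->] [y Gy ->]]; first by exists 0.
    by exists (k *: x + y) => //; exact: GD.
  - by move=> _ [x _ ->]; exact: griessP.
  - move=> _ _ [x Gx ->] [y Gy ->]; exists (2 *: mul x y).
      exact/(subspace_Z (lspan_subspace _) _)/graph_closed.
    by rewrite /= /griess_mul scalerA mulfV ?scale1r // pnatr_eq0.
by move=> _ [->|->]; [exists a|exists c].
Qed.

(** The difference has first component 0, so by [graph_form] its second component has norm 0. *)
Lemma graph_inj x y : graph x -> graph y -> x.1 = y.1 -> x.2 = y.2.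
Proof.
move=> Gx Gy xy; have Gxy : graph (x - y).
  apply: (subspace_D (lspan_subspace _)) => //.
  exact: (subspace_N (lspan_subspace _)).
apply/eqP; rewrite -subr_eq0; apply/eqP; apply: (form_eq0 (gform_pos hb')).
rewrite -[LHS](graph_form Gxy Gxy) /= xy subrr.
exact: (form_0r (gform_lin hb)).
Qed.

End Comparison.

Section Transport.
Variables (R : realType) (V V' : voa R) (G : set (griess V * griess V')).

Definition transport (v : V) : V' :=
  xget 0 [set v' | exists2 z, G z & v = gval z.1 /\ v' = gval z.2].

Lemma transportE z : (forall x y, G x -> G y -> x.1 = y.1 -> x.2 = y.2) ->
  G z -> transport (gval z.1) = gval z.2.
Proof.
move=> Ginj Gz; apply: xget_unique; first by exists z.
by move=> v' [x Gx [/gval_inj zx ->]]; congr gval; exact: Ginj.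
Qed.

End Transport.

Section Main.
Variables (R : realType) (V V' : voa R) (e f : V) (e' f' : V').
Hypotheses (hV : standing V) (he : ising e) (hf : ising f).
Hypotheses (hV' : standing V') (he' : ising e') (hf' : ising f').
Hypothesis l_eq : norm_form e' f' = norm_form e f.
Hypothesis m_eq : norm_form e' (tau f' e') = norm_form e (tau f e).

Lemma griess_gen_compare : dim_le (griess_gen e f) 8 /\
  exists phi : V -> V', [/\ griess_isometry (griess_gen e f) (griess_gen e' f') phi,
    phi e = e' & phi f = f'].
Proof.
have [b hb] := standing_adjoint_form hV; have [b' hb'] := standing_adjoint_form hV'.
have [ce _] := he; have [cf _] := hf; have [ce' _] := he'; have [cf' _] := hf'.
have [e2 _ _] := ce; have [f2 _ _] := cf; have [e2' _ _] := ce'; have [f2' _ _] := cf'.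
pose E := to_griess e2; pose F := to_griess f2.
pose E' := to_griess e2'; pose F' := to_griess f2'.
have cE : conformal_vector (1 / 2%:R) (gval E) := ce.
have cF : conformal_vector (1 / 2%:R) (gval F) := cf.
have cE' : conformal_vector (1 / 2%:R) (gval E') := ce'.
have cF' : conformal_vector (1 / 2%:R) (gval F') := cf'.
have lE : gform b' E' F' = gform b E F.
  by rewrite -(norm_form_gform hV hb cE) -(norm_form_gform hV' hb' cE').
have mE : gform b' E' (gtau f' E') = gform b E (gtau f E).
  rewrite -(norm_form_gform hV hb cE) -(norm_form_gform hV' hb' cE').
  by rewrite (gtauE hV hb cF) (gtauE hV' hb' cF').
pose G := graph E F E' F'.
have sG : subspace G := lspan_subspace _.
have [[GE GF _ _ _] _] := dihedral_gens_mem (pmul (@gmul R V) (@gmul R V')) (E, E') (F, F')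
  (pmap (gtau e) (gtau e')) (pmap (gtau f) (gtau f')).
have Gsub z : G z -> griess_gen e f (gval z.1) /\ griess_gen e' f' (gval z.2).
  exact: (graph_sub hV hb hV' hb' cE cF cE' cF').
have Gsurj v : griess_gen e f v -> exists2 z, G z & v = gval z.1.
  exact: (graph_surj hV hb hV' hb' cE cF cE' cF' lE mE).
have Gform x y : G x -> G y -> gform b x.1 y.1 = gform b' x.2 y.2.
  exact: (graph_form hV hb hV' hb' cE cF cE' cF' lE mE).
have Gmul x y : G x -> G y -> G (pmul (@gmul R V) (@gmul R V') x y).
  exact: (graph_closed hV hb hV' hb' cE cF cE' cF' lE mE).
have Ginj x y : G x -> G y -> x.1 = y.1 -> x.2 = y.2.
  exact: (graph_inj hV hb hV' hb' cE cF cE' cF' lE mE).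
have Ginj' x y : G x -> G y -> x.2 = y.2 -> x.1 = y.1.
  move=> Gx Gy xy; have Gxy : G (x - y).
    by apply: (subspace_D sG) => //; exact: (subspace_N sG).
  apply/eqP; rewrite -subr_eq0; apply/eqP; apply: (form_eq0 (gform_pos hb)).
  rewrite [LHS](Gform _ _ Gxy Gxy) /= xy subrr.
  exact: (form_0r (gform_lin hb')).
have Gsurj' v' : griess_gen e' f' v' -> exists2 z, G z & v' = gval z.2.
  exact: (graph_surj' hV hb hV' hb' cE cF cE' cF' lE mE).
split.
  (* The first components of the eight generators of the graph span the subalgebra. *)
  pose B := gens E F E' F'; exists (fun i : 'I_8 => gval (B`_i).1); split=> [i|v].
    by have [] := Gsub _ (@lspan_nth _ _ B i (ltn_ord i)).
  move=> /Gsurj[_ [k ->] ->]; exists (fun i => k i).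
  by elim/big_ind2: _ => //= x x1 y y1 -> <-.
exists (transport G).
have tr z : G z -> transport G (gval z.1) = gval z.2 by exact: transportE Ginj.
split; [split|exact: tr GE|exact: tr GF].
- split.
  + by move=> _ /Gsurj[z Gz ->]; rewrite /= tr //; case: (Gsub z Gz).
  + move=> _ _ /set_mem/Gsurj[x Gx ->] /set_mem/Gsurj[y Gy ->]; rewrite !tr // => xy.
    by congr gval; apply: Ginj' => //; exact: gval_inj.
  + move=> v' /Gsurj'[z Gz ->]; exists (gval z.1); last by rewrite tr.
    by case: (Gsub z Gz).
- move=> k _ _ /Gsurj[x Gx ->] /Gsurj[y Gy ->]; rewrite !tr // -!gvalD.
  by apply: (tr (k *: x + y)); case: sG => _; apply.
- have mulE (U : voa R) (x y : griess U) : griess_mul (gval x) (gval y) = gval (2 *: gmul x y).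
    by rewrite /= scalerA mulfV ?scale1r // pnatr_eq0.
  move=> _ _ /Gsurj[x Gx ->] /Gsurj[y Gy ->]; rewrite !tr // !mulE.
  by apply: (tr (2 *: pmul (@gmul R V) (@gmul R V') x y)); apply: (subspace_Z sG _); exact: Gmul.
- move=> _ _ /Gsurj[x Gx ->] /Gsurj[y Gy ->]; rewrite !tr //.
  rewrite (griess_form_adjoint hV hb) ?(griess_form_adjoint hV' hb'); try exact: griessP.
  by have := Gform x y Gx Gy; rewrite /gform => /mulfI ->; rewrite // pnatr_eq0.
Qed.

End Main.

Theorem theorem3p6 (R : realType) (V : voa R) (e f : V)
    (hV : standing V) (he : ising e) (hf : ising f) :
  dim_le (griess_gen e f) 8 /\
  forall (V' : voa R) (e' f' : V'),
    standing V' -> ising e' -> ising f' ->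
    norm_form e' f' = norm_form e f ->
    norm_form e' (tau f' e') = norm_form e (tau f e) ->
    exists phi : V -> V',
      [/\ griess_isometry (griess_gen e f) (griess_gen e' f') phi,
          phi e = e' & phi f = f'].
Proof.
(* The dimension bound comes from comparing (e, f) with itself. *)
split; first by have [] := griess_gen_compare hV he hf hV he hf erefl erefl.
move=> V' e' f' hV' he' hf' l_eq m_eq.
by have [] := griess_gen_compare hV he hf hV' he' hf' l_eq m_eq.
Qed.
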